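(* Let $\Omega\subseteq\mathbb{H}$ be a domain and let $$\mathcal{A}(\Omega)=\{p\in\Omega : 2|Im(p)|<\sigma(p,\partial_\sigma\Omega)\},$$ where $\partial_\sigma\Omega$ denotes the boundary of $\Omega$ with respect to the topology induced by the distance $\sigma$. Then every slice regular function $f:\Omega\to\mathbb{H}$ is quaternionic analytic at every point of $\mathcal{A}(\Omega)$. Moreover, if $\Omega$ intersects the real axis, then $\mathcal{A}(\Omega)$ contains a (Euclidean) neighborhood of $\Omega\cap\mathbb{R}$.
   Context: $\mathbb{H}$ is the skew field of real quaternions, with real part $Re(q)$, imaginary part $Im(q)$ and Euclidean modulus $|q|$. A domain is a nonempty connected open subset for the Euclidean topology. Let $\mathbb{S}=\{q\in\mathbb{H}:q^2=-1\}$ and, for $I\in\mathbb{S}$, $L_I=\mathbb{R}+I\mathbb{R}$ (a ''complex line''). Distance $\sigma$: for $p,q\in\mathbb{H}$ put $\omega(q,p)=\sqrt{[Re(q)-Re(p)]^2+[|Im(q)|+|Im(p)|]^2}$, and let $\sigma(q,p)=|q-p|$ if $p,q$ lie in a common complex line $L_I$, and $\sigma(q,p)=\omega(q,p)$ otherwise. The map $\sigma$ is a distance on $\mathbb{H}$ whose topology is finer than the Euclidean one. For a set $T$, $\sigma(p,T)=\inf_{t\in T}\sigma(p,t)$, with $\sigma(p,\emptyset)=+\infty$. Slice regularity: for $I\in\mathbb{S}$ put $\Omega_I=\Omega\cap L_I$ and $f_I=f|_{\Omega_I}$. A function $f:\Omega\to\mathbb{H}$ is slice regular if for every $I\in\mathbb{S}$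 the restriction $f_I$ is holomorphic, i.e. it is real differentiable on $\Omega_I$ and $\frac12\left(\frac{\partial}{\partial x}+I\frac{\partial}{\partial y}\right)f_I(x+Iy)=0$ for all $x+Iy\in\Omega_I$. The regular multiplication $*$ of polynomials/power series with right coefficients is $\left(\sum_n q^n a_n\right)*\left(\sum_n q^n b_n\right)=\sum_n q^n\sum_{k=0}^n a_kb_{n-k}$, and $(q-p)^{*n}$ is the $n$-th power of $q-p$ with respect to $*$ (with $(q-p)^{*0}=1$). Quaternionic analyticity: $f:\Omega\to\mathbb{H}$ is quaternionic analytic at $p\in\Omega$ if there exist a Euclidean neighborhood $U$ of $p$ in $\Omega$ and a series $\sum_n(q-p)^{*n}b_n$ ($b_n\in\mathbb{H}$) converging in $U$ such that $f(q)=\sum_n(q-p)^{*n}b_n$ for all $q\in U$. *)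

(* Defs.v *)
From HB Require Import structures.
From mathcomp Require Import all_boot all_order all_algebra.
From mathcomp Require Import all_classical all_reals all_analysis.
From mathcomp Require Import ring lra.

Set Implicit Arguments.
Unset Strict Implicit.
Unset Printing Implicit Defensive.
Import Order.TTheory GRing.Theory Num.Theory.
Import numFieldNormedType.Exports.

Local Open Scope classical_set_scope.
Local Open Scope ring_scope.

(* The row (a, b, c, d) stands for a + b i + c j + d k. The library norm on
   rows is the sup norm: it induces the Euclidean topology, but it is not the
   Euclidean modulus, which is [qabs] below. *)
Definition quat (R : realType) : Type := 'rV[R]_4.

HB.instance Definition _ (R : realType) :=
  NormedModule.copy (quat R) 'rV[R]_4.
HB.instance Definition _ (R : realType) := Complete.copy (quat R) 'rV[R]_4.

Section QuaternionRing.
Variable R : realType.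
Implicit Types p q : quat R.

Definition mkquat (a b c d : R) : quat R := \row_(l < 4) [:: a; b; c; d]`_l.

Definition qRe q : R := q 0 (@Ordinal 4 0 isT).
Definition qI q : R := q 0 (@Ordinal 4 1 isT).
Definition qJ q : R := q 0 (@Ordinal 4 2 isT).
Definition qK q : R := q 0 (@Ordinal 4 3 isT).

Lemma quat_ext p q :
  qRe p = qRe q -> qI p = qI q -> qJ p = qJ q -> qK p = qK q -> p = q.
Proof.
move=> h0 h1 h2 h3; apply/rowP => -[[|[|[|[|n]]]] hn] //.
- by rewrite (_ : Ordinal hn = Ordinal (isT : (0 < 4)%N)) //; apply: val_inj.
- by rewrite (_ : Ordinal hn = Ordinal (isT : (1 < 4)%N)) //; apply: val_inj.
- by rewrite (_ : Ordinal hn = Ordinal (isT : (2 < 4)%N)) //; apply: val_inj.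
- by rewrite (_ : Ordinal hn = Ordinal (isT : (3 < 4)%N)) //; apply: val_inj.
Qed.

Lemma qRe_mk a b c d : qRe (mkquat a b c d) = a. Proof. by rewrite /qRe mxE. Qed.
Lemma qI_mk a b c d : qI (mkquat a b c d) = b. Proof. by rewrite /qI mxE. Qed.
Lemma qJ_mk a b c d : qJ (mkquat a b c d) = c. Proof. by rewrite /qJ mxE. Qed.
Lemma qK_mk a b c d : qK (mkquat a b c d) = d. Proof. by rewrite /qK mxE. Qed.
Lemma qReD p q : qRe (p + q) = qRe p + qRe q. Proof. exact: mxE. Qed.
Lemma qID p q : qI (p + q) = qI p + qI q. Proof. exact: mxE. Qed.
Lemma qJD p q : qJ (p + q) = qJ p + qJ q. Proof. exact: mxE. Qed.
Lemma qKD p q : qK (p + q) = qK p + qK q. Proof. exact: mxE. Qed.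
Lemma qReN p : qRe (- p) = - qRe p. Proof. exact: mxE. Qed.
Lemma qIN p : qI (- p) = - qI p. Proof. exact: mxE. Qed.
Lemma qJN p : qJ (- p) = - qJ p. Proof. exact: mxE. Qed.
Lemma qKN p : qK (- p) = - qK p. Proof. exact: mxE. Qed.
Lemma qReZ (x : R) p : qRe (x *: p) = x * qRe p. Proof. exact: mxE. Qed.
Lemma qIZ (x : R) p : qI (x *: p) = x * qI p. Proof. exact: mxE. Qed.
Lemma qJZ (x : R) p : qJ (x *: p) = x * qJ p. Proof. exact: mxE. Qed.
Lemma qKZ (x : R) p : qK (x *: p) = x * qK p. Proof. exact: mxE. Qed.
Lemma qRe0 : qRe 0 = 0. Proof. exact: mxE. Qed.
Lemma qI0 : qI 0 = 0. Proof. exact: mxE. Qed.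
Lemma qJ0 : qJ 0 = 0. Proof. exact: mxE. Qed.
Lemma qK0 : qK 0 = 0. Proof. exact: mxE. Qed.

Definition qone : quat R := mkquat 1 0 0 0.

Definition qmul p q : quat R := mkquat
  (qRe p * qRe q - qI p * qI q - qJ p * qJ q - qK p * qK q)
  (qRe p * qI q + qI p * qRe q + qJ p * qK q - qK p * qJ q)
  (qRe p * qJ q - qI p * qK q + qJ p * qRe q + qK p * qI q)
  (qRe p * qK q + qI p * qJ q - qJ p * qI q + qK p * qRe q).

Definition quat_coordE :=
  (qRe_mk, qI_mk, qJ_mk, qK_mk, qReD, qID, qJD, qKD, qReN, qIN, qJN, qKN,
   qReZ, qIZ, qJZ, qKZ, qRe0, qI0, qJ0, qK0).

Fact qmulA : associative qmul.
Proof. by move=> p q r; apply: quat_ext; rewrite /qmul !quat_coordE; ring. Qed.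
Fact qmul1l : left_id qone qmul.
Proof. by move=> p; apply: quat_ext; rewrite /qmul !quat_coordE; ring. Qed.
Fact qmul1r : right_id qone qmul.
Proof. by move=> p; apply: quat_ext; rewrite /qmul !quat_coordE; ring. Qed.
Fact qmulDl : left_distributive qmul +%R.
Proof. by move=> p q r; apply: quat_ext; rewrite /qmul !quat_coordE; ring. Qed.
Fact qmulDr : right_distributive qmul +%R.
Proof. by move=> p q r; apply: quat_ext; rewrite /qmul !quat_coordE; ring. Qed.
Fact qone_neq0 : qone != 0.
Proof.
apply/eqP => /(congr1 qRe); rewrite !quat_coordE => /eqP.
by rewrite oner_eq0.
Qed.

HB.instance Definition _ := GRing.Zmodule_isNzRing.Build (quat R)
  qmulA qmul1l qmul1r qmulDl qmulDr qone_neq0.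

Lemma qRe1 : qRe 1 = 1. Proof. exact: qRe_mk. Qed.
Lemma qI1 : qI 1 = 0. Proof. exact: qI_mk. Qed.
Lemma qJ1 : qJ 1 = 0. Proof. exact: qJ_mk. Qed.
Lemma qK1 : qK 1 = 0. Proof. exact: qK_mk. Qed.

Lemma quat_mulE p q : p * q = qmul p q. Proof. by []. Qed.

End QuaternionRing.

Section Quaternions.
Variable R : realType.
Implicit Types p q I : quat R.

Definition qIm q : quat R := mkquat 0 (qI q) (qJ q) (qK q).

Definition qabs q : R :=
  Num.sqrt (qRe q ^+ 2 + qI q ^+ 2 + qJ q ^+ 2 + qK q ^+ 2).

Definition real_axis : set (quat R) := [set x *: (1 : quat R) | x in [set: R]].

Definition sphereS : set (quat R) := [set q | q ^+ 2 = -1].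

Definition slice_pt I (z : R * R) : quat R := z.1 *: (1 : quat R) + z.2 *: I.

Definition complex_line I : set (quat R) := range (slice_pt I).

Definition common_line p q : Prop :=
  exists I, [/\ sphereS I, complex_line I p & complex_line I q].

Definition omega q p : R :=
  Num.sqrt ((qRe q - qRe p) ^+ 2 + (qabs (qIm q) + qabs (qIm p)) ^+ 2).

Definition sigma q p : R :=
  if `[< common_line p q >] then qabs (q - p) else omega q p.

End Quaternions.

Section SigmaMetric.
Variable R : realType.
Implicit Types p q r I J : quat R.

Let norm2 (a b : R) : R := Num.sqrt (a ^+ 2 + b ^+ 2).

Lemma qabs_triangle p q : qabs (p + q) <= qabs p + qabs q.
Proof.
rewrite /qabs !quat_coordE.
move: (qRe p) (qI p) (qJ p) (qK p) (qRe q) (qI q) (qJ q) (qK q).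
move=> a b c d x y z t.
set A := (X in _ <= Num.sqrt X + _); set B := (X in _ <= _ + Num.sqrt X).
have sq (u : R) : 0 <= u ^+ 2 by exact: sqr_ge0.
have A0 : 0 <= A by rewrite !addr_ge0.
have B0 : 0 <= B by rewrite !addr_ge0.
set C := a * x + b * y + c * z + d * t.
have CAB : C <= Num.sqrt A * Num.sqrt B.
  rewrite -sqrtrM //; apply: (le_trans (ler_norm C)).
  rewrite -sqrtr_sqr; apply: ler_wsqrtr; rewrite -subr_ge0.
  have -> : A * B - C ^+ 2 = (a * y - b * x) ^+ 2 + (a * z - c * x) ^+ 2
     + (a * t - d * x) ^+ 2 + (b * z - c * y) ^+ 2 + (b * t - d * y) ^+ 2
     + (c * t - d * z) ^+ 2 by rewrite /A /B /C; ring.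
  by rewrite !addr_ge0.
have S0 : 0 <= Num.sqrt A + Num.sqrt B by rewrite addr_ge0 ?sqrtr_ge0.
rewrite -(ger0_norm S0) -sqrtr_sqr; apply: ler_wsqrtr.
rewrite [leRHS]sqrrD !sqr_sqrtr //.
have -> : (a + x) ^+ 2 + (b + y) ^+ 2 + (c + z) ^+ 2 + (d + t) ^+ 2 =
  A + C *+ 2 + B by rewrite /A /B /C; ring.
by rewrite lerD2r lerD2l lerMn2r.
Qed.

Lemma qabs_ge0 p : 0 <= qabs p. Proof. exact: sqrtr_ge0. Qed.

Lemma qabs0 : qabs (0 : quat R) = 0.
Proof. by rewrite /qabs !quat_coordE expr0n /= !addr0 sqrtr0. Qed.

Lemma qabsN p : qabs (- p) = qabs p.
Proof. by rewrite /qabs !quat_coordE !sqrrN. Qed.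

Lemma qabs_eq0 p : qabs p = 0 -> p = 0.
Proof.
have sq (u : R) : 0 <= u ^+ 2 by exact: sqr_ge0.
move=> /eqP; rewrite sqrtr_eq0 => h.
have /eqP : qRe p ^+ 2 + qI p ^+ 2 + qJ p ^+ 2 + qK p ^+ 2 = 0.
  by apply/eqP; rewrite eq_le h !addr_ge0.
rewrite !paddr_eq0 ?addr_ge0 // !sqrf_eq0.
move=> /andP[/andP[/andP[/eqP h0 /eqP h1] /eqP h2] /eqP h3].
by apply: quat_ext; rewrite !quat_coordE.
Qed.

Let norm2_triangle (a b c d : R) :
  norm2 (a + c) (b + d) <= norm2 a b + norm2 c d.
Proof.
have := qabs_triangle (mkquat a b 0 0) (mkquat c d 0 0).
by rewrite /qabs !quat_coordE !addr0 expr0n /= !addr0.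
Qed.

Let le_norm2 (a b c : R) : `|b| <= `|c| -> norm2 a b <= norm2 a c.
Proof.
move=> bc; apply: ler_wsqrtr; rewrite lerD2l.
by rewrite -(real_normK (num_real b)) -(real_normK (num_real c)) lerXn2r.
Qed.

Lemma qImB p q : qIm (p - q) = qIm p - qIm q.
Proof. by apply: quat_ext; rewrite /qIm !quat_coordE // subr0. Qed.

Let qabsE p : qabs p = norm2 (qRe p) (qabs (qIm p)).
Proof.
rewrite /norm2 /qabs sqr_sqrtr; last by rewrite !addr_ge0 ?sqr_ge0.
by rewrite /qIm !quat_coordE expr0n /= add0r !addrA.
Qed.

Let qabs_ge p q :
  norm2 (qRe p - qRe q) (qabs (qIm p) - qabs (qIm q)) <= qabs (p - q).
Proof.
rewrite (qabsE (p - q)) qReD qReN qImB; apply: le_norm2.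
rewrite [leRHS]ger0_norm ?qabs_ge0 // ler_norml.
have h1 := qabs_triangle (qIm p - qIm q) (qIm q).
have h2 := qabs_triangle (qIm q - qIm p) (qIm p).
rewrite !subrK in h1 h2; rewrite -opprB qabsN in h2.
by apply/andP; split; lra.
Qed.

Lemma qabs_le_omega p q : qabs (p - q) <= omega p q.
Proof.
rewrite (qabsE (p - q)) qReD qReN qImB; apply: le_norm2.
rewrite !ger0_norm ?addr_ge0 ?qabs_ge0 //.
by rewrite -[X in _ <= _ + X]qabsN qabs_triangle.
Qed.

Lemma qabs_le_sigma p q : qabs (p - q) <= sigma p q.
Proof. by rewrite /sigma; case: ifP => // _; exact: qabs_le_omega. Qed.

Lemma sphereS_Re I : sphereS I -> qRe I = 0.
Proof.
rewrite /sphereS /= expr2 quat_mulE => h.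
have h0 := congr1 (@qRe R) h; have h1 := congr1 (@qI R) h.
have h2 := congr1 (@qJ R) h; have h3 := congr1 (@qK R) h.
move: h0 h1 h2 h3.
rewrite /qmul !quat_coordE ?qRe1 ?qI1 ?qJ1 ?qK1 ?oppr0.
set a := qRe I; set b := qI I; set c := qJ I; set d := qK I.
move=> h0 h1 h2 h3; apply/eqP; apply/negPn/negP => a0.
have z (x : R) : a * x + x * a = 0 -> x = 0.
  rewrite [x * a]mulrC -mulr2n => /eqP; rewrite mulrn_eq0 /= mulf_eq0.
  by rewrite (negbTE a0) => /eqP.
have b0 : b = 0 by apply: z; rewrite -h1; ring.
have c0 : c = 0 by apply: z; rewrite -h2; ring.
have d0 : d = 0 by apply: z; rewrite -h3; ring.
have : 0 <= a * a by rewrite -expr2 sqr_ge0.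
by rewrite b0 c0 d0 in h0; lra.
Qed.

Lemma common_lineC p q : common_line p q -> common_line q p.
Proof. by case=> I [] ? ? ?; exists I. Qed.

Lemma common_line_refl p : common_line p p.
Proof.
have [h|h] := eqVneq (qabs (qIm p)) 0.
  have h' := qabs_eq0 h.
  have h1 := congr1 (@qI R) h'; have h2 := congr1 (@qJ R) h'.
  have h3 := congr1 (@qK R) h'; rewrite /qIm !quat_coordE in h1 h2 h3.
  exists (mkquat 0 1 0 0).
  have hp : complex_line (mkquat 0 1 0 0) p.
    exists (qRe p, 0) => //; apply: quat_ext; rewrite /slice_pt /= !quat_coordE;
    by rewrite ?qRe1 ?qI1 ?qJ1 ?qK1 ?h1 ?h2 ?h3; ring.
  split=> //; rewrite /sphereS /= expr2 quat_mulE; apply: quat_ext;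
  by rewrite /qmul !quat_coordE ?qRe1 ?qI1 ?qJ1 ?qK1; ring.
set m := qabs (qIm p).
have m2 : m ^+ 2 = qI p ^+ 2 + qJ p ^+ 2 + qK p ^+ 2.
  rewrite /m /qabs sqr_sqrtr; last by rewrite !addr_ge0 ?sqr_ge0.
  by rewrite /qIm !quat_coordE expr0n /= add0r.
exists (m^-1 *: qIm p).
have hp : complex_line (m^-1 *: qIm p) p.
  exists (qRe p, m) => //; rewrite /slice_pt /= scalerA divff // scale1r.
  apply: quat_ext; rewrite /qIm !quat_coordE ?qRe1 ?qI1 ?qJ1 ?qK1; ring.
split=> //; rewrite /sphereS /= expr2 quat_mulE.
apply: quat_ext; rewrite /qmul /qIm !quat_coordE ?qRe1 ?qI1 ?qJ1 ?qK1; try ring.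
have -> : -1 = - (m^-1 ^+ 2 * m ^+ 2) :> R by rewrite -exprMn mulVf // expr1n.
by rewrite m2; ring.
Qed.

Lemma common_line_trans q p r : qabs (qIm q) != 0 ->
  common_line p q -> common_line q r -> common_line p r.
Proof.
move=> q0 [I [SI [u _ pE] [v _ qE]]] [J [SJ [v' _ qE'] [w _ rE]]].
have I0 := sphereS_Re SI; have J0 := sphereS_Re SJ.
have e : v.2 *: I = v'.2 *: J.
  move: qE'; rewrite -qE /slice_pt => h.
  have h0 := congr1 (@qRe R) h; have h1 := congr1 (@qI R) h.
  have h2 := congr1 (@qJ R) h; have h3 := congr1 (@qK R) h.
  move: h0 h1 h2 h3; rewrite !quat_coordE ?qRe1 ?qI1 ?qJ1 ?qK1 I0 J0.
  move=> h0 h1 h2 h3; apply: quat_ext; rewrite !quat_coordE ?I0 ?J0; lra.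
have v0 : v'.2 != 0.
  apply/eqP => v0; move/eqP: q0; apply; rewrite -qE' /slice_pt v0.
  rewrite /qabs /qIm !quat_coordE ?qI1 ?qJ1 ?qK1 !mulr0 mul0r !addr0 mul0r.
  by rewrite mul0r !add0r expr0n /= !addr0 sqrtr0.
exists I; split=> //; first by exists u.
exists (w.1, w.2 / v'.2 * v.2) => //.
rewrite -rE /slice_pt /=; congr (_ + _).
by rewrite -scalerA e scalerA divfK.
Qed.

Lemma omegaC p q : omega p q = omega q p.
Proof. by rewrite /omega -[qRe p - _]opprB sqrrN [qabs _ + _]addrC. Qed.

Lemma sigmaC p q : sigma p q = sigma q p.
Proof.
rewrite /sigma (_ : `[< common_line q p >] = `[< common_line p q >]).
  by rewrite omegaC -[p - q]opprB qabsN.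
by apply/asboolP/asboolP; exact: common_lineC.
Qed.

Lemma sigmaxx p : sigma p p = 0.
Proof.
by rewrite /sigma asboolT ?subrr ?qabs0 //; exact: common_line_refl.
Qed.

Lemma sigma_eq0 p q : sigma p q = 0 -> p = q.
Proof.
move=> h; apply/eqP; rewrite -subr_eq0; apply/eqP/qabs_eq0/eqP.
by rewrite eq_le qabs_ge0 -h qabs_le_sigma.
Qed.

Let omega_le q p r : omega p r <= omega p q + qabs (q - r).
Proof.
apply: (@le_trans _ _ (omega p q +
  norm2 (qRe q - qRe r) (qabs (qIm r) - qabs (qIm q)))).
  have := norm2_triangle (qRe p - qRe q) (qabs (qIm p) + qabs (qIm q))
     (qRe q - qRe r) (qabs (qIm r) - qabs (qIm q)).
  by rewrite /omega /norm2 addrA subrK [in X in X -> _]addrACA subrr addr0.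
rewrite lerD2l; apply: le_trans (qabs_ge q r).
by apply: le_norm2; rewrite distrC.
Qed.

Lemma sigma_triangle q p r : sigma p r <= sigma p q + sigma q r.
Proof.
rewrite {1}/sigma; case: asboolP => [_|npr].
  rewrite -[p - r](subrKA q); apply: (le_trans (qabs_triangle _ _)).
  by rewrite lerD ?qabs_le_sigma.
have [cpq|ncpq] := asboolP (common_line q p); last first.
  rewrite {1}/sigma asboolF //; apply: (le_trans (omega_le q p r)).
  by rewrite lerD2l qabs_le_sigma.
have [cqr|ncqr] := asboolP (common_line r q); last first.
  rewrite {2}/sigma asboolF // omegaC [omega q r]omegaC addrC.
  apply: (le_trans (omega_le q r p)); rewrite lerD2l.
  by rewrite sigmaC qabs_le_sigma.
have [q0|q0] := eqVneq (qabs (qIm q)) 0; last first.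
  by case: npr; exact: common_line_trans q0 cqr cpq.
apply: (le_trans (omega_le q p r)); apply: lerD; last exact: qabs_le_sigma.
apply: le_trans (qabs_le_sigma p q); apply: le_trans (qabs_ge p q).
by rewrite /omega q0 /norm2 addr0 subr0.
Qed.

End SigmaMetric.

(* Copy of the quaternions carrying the topology of the distance sigma. *)
Definition squat (R : realType) : Type := quat R.

HB.instance Definition _ (R : realType) := Choice.on (squat R).
HB.instance Definition _ (R : realType) := isMetric.Build R (squat R)
  (@sigmaxx R) (@sigma_eq0 R) (@sigmaC R) (@sigma_triangle R).

Section SliceRegular.
Variable R : realType.
Implicit Types (p q : quat R) (T Omega : set (quat R)) (f : quat R -> quat R).

Definition domain Omega : Prop :=
  [/\ Omega !=set0, open Omega & connected Omega].

Definition sigma_boundary T : set (quat R) :=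
  let T' : set (squat R) := T in closure T' `\` interior T'.

(* In \bar R, so that the distance to the empty set is +oo. *)
Definition sigma_dist p T : \bar R := ereal_inf [set (sigma p t)%:E | t in T].

Definition analytic_locus Omega : set (quat R) :=
  [set p | Omega p /\
    ((2 * qabs (qIm p))%:E < sigma_dist p (sigma_boundary Omega))%E].

(* Functions on Omega are total functions of which only the values on Omega
   matter; since Omega is open, differentiability and partial derivatives of
   the restriction to a complex line are determined by these values. *)
Definition slice_regular Omega f : Prop :=
  forall I, sphereS I -> forall z : R * R, Omega (slice_pt I z) ->
    differentiable (f \o slice_pt I) z /\
    2^-1 *: ('D_(1, 0) (f \o slice_pt I) z
             + I * 'D_(0, 1) (f \o slice_pt I) z) = 0.

(* Evaluation with coefficients on the right (the library's p.[q] puts them on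
   the left). As the indeterminate of {poly quat R} commutes with the
   coefficients, the product of {poly quat R} is the regular product. *)
Definition horner_right (P : {poly quat R}) q : quat R :=
  \sum_(k < size P) q ^+ k * P`_k.

Definition regular_pow p n q : quat R := horner_right (('X - p%:P) ^+ n) q.

Definition quaternionic_analytic Omega f p : Prop :=
  exists (U : set (quat R)) (b : nat -> quat R),
    [/\ nbhs p U, U `<=` Omega &
        forall q, U q ->
          series (fun n => regular_pow p n q * b n) @ \oo --> f q].

End SliceRegular.

(* Main.v *)
(* Goursat's argument, run on the form A dtheta + B dt with
   A = E^-1 rho e^(J theta) f(q + t E), B = - J t^-1 f(q + t E) and
   E = c + rho e^(J theta) - q, gives Cauchy's formula, hence a Taylor expansion
   at c on every closed disc of a complex line L_J on which f is defined.

   Let p = a + I b with b >= 0 and 2 b < rho < sigma(p, boundary). Moving along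
   segments of complex lines without meeting the sigma-boundary, one sees that
   Omega contains the disc of center p and radius rho of L_I and the Euclidean
   ball of center a and radius rho - b > b. In this ball the Taylor expansions at
   a on the lines L_J all have the same coefficients, as they agree on the real
   axis, so f(x + J y) is determined by f(x + I y) and f(x - I y) through the
   representation formula. The regular powers of q - p satisfy this formula too,
   hence the Taylor expansion of f at p in L_I extends to the ball, which is a
   neighborhood of p. *)
Require Import Defs.
From mathcomp Require Import all_boot all_order all_algebra.
From mathcomp Require Import all_classical all_reals all_analysis.
From mathcomp Require Import ring lra.

Set Implicit Arguments.
Unset Strict Implicit.
Unset Printing Implicit Defensive.
Import Order.TTheory GRing.Theory Num.Theory.
Import numFieldNormedType.Exports.
Local Open Scope classical_set_scope.
Local Open Scope ring_scope.

(** * Integration over segments and Goursat's theorem *)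

(** Slice regularity gives differentiability at each point of a complex line but no continuity of
    the derivatives, so Green's formula is obtained by subdivision. The form of the overview is the
    pullback of - J dw (w - q)^-1 f(w) by w = q + t E. It is integrated for t in [a, 1] with a > 0,
    since its dt part is singular at t = 0. The sides theta = 0 and theta = 2 pi cancel by
    periodicity, so the loops t = 1 and t = a have the same integral, and a -> 0 leaves the integral
    of the kernel times f(q). The integral of the kernel is read off from its geometric expansion.

    Noncommutativity is kept under control by sides: factors in the line L_J stay on the left of f
    and commute with each other, while derivatives and coefficients, which are arbitrary
    quaternions, stay on the right.

    The 2 in the locus comes from the detour through the real axis: a point q of another line is
    compared with p through the real point a, and sigma(p, q) <= b + |q - a|. This costs b, hence
    the radius rho - b, and the ball of this radius around a contains p exactly when b < rho - b. *)

Section SegmentIntegral.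
Variable R : realType.
Implicit Types (a b c d x y k : R) (f g : R -> R).

(** Two-sided continuity at each point of the segment, endpoints included, rather than continuity
    within the segment: it composes pointwise, and the integrands below satisfy it because they
    extend past the endpoints. *)
Definition cont_on (V : topologicalType) a b (f : R -> V) : Prop :=
  forall x, a <= x <= b -> {for x, continuous f}.

Definition seg_int a b f : R :=
  (\int[@lebesgue_measure R]_(x in `[a, b]) f x)%R.

Lemma cont_on_sub (V : topologicalType) a b c d (f : R -> V) :
  a <= c -> d <= b -> cont_on a b f -> cont_on c d f.
Proof.
move=> ac db cf x /andP[cx xd]; apply: cf.
by rewrite (le_trans ac cx) (le_trans xd db).
Qed.

Lemma cont_on_within a b f : cont_on a b f -> {within `[a, b], continuous f}.
Proof.
move=> cf; apply: continuous_in_subspaceT => x; rewrite inE /= in_itv /=.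
exact: cf.
Qed.

Lemma cont_on_integrable a b f : cont_on a b f ->
  (@lebesgue_measure R).-integrable `[a, b] (EFin \o f).
Proof.
move=> cf; apply: continuous_compact_integrable; first exact: segment_compact.
exact: cont_on_within.
Qed.

Lemma eq_seg_int a b f g : (forall x, a <= x <= b -> f x = g x) ->
  seg_int a b f = seg_int a b g.
Proof.
move=> fg; apply: eq_Rintegral => x; rewrite inE /= in_itv /=; exact: fg.
Qed.

Lemma seg_intD a b f g : cont_on a b f -> cont_on a b g ->
  seg_int a b (fun x => f x + g x) = seg_int a b f + seg_int a b g.
Proof. by move=> cf cg; apply: RintegralD => //; exact: cont_on_integrable. Qed.

Lemma seg_intB a b f g : cont_on a b f -> cont_on a b g ->
  seg_int a b (fun x => f x - g x) = seg_int a b f - seg_int a b g.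
Proof. by move=> cf cg; apply: RintegralB => //; exact: cont_on_integrable. Qed.

Lemma seg_intZ a b k f : cont_on a b f ->
  seg_int a b (fun x => k * f x) = k * seg_int a b f.
Proof. by move=> cf; apply: RintegralZl => //; exact: cont_on_integrable. Qed.

Lemma seg_int_cst a b k : a <= b -> seg_int a b (fun=> k) = k * (b - a).
Proof.
move=> ab; rewrite /seg_int Rintegral_cst//; congr (_ * _).
rewrite (_ : fine _ = fine (lebesgue_measure (`[a, b] : set R))) //.
rewrite lebesgue_measure_itv /= lte_fin.
by case: ltgtP ab => // ->; rewrite subrr.
Qed.

Lemma le_seg_int a b f k : a <= b -> cont_on a b f ->
  (forall x, a <= x <= b -> `|f x| <= k) -> `|seg_int a b f| <= k * (b - a).
Proof.
move=> ab cf fk; apply: le_trans (le_normr_Rintegral _ _) _ => //.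
  exact: cont_on_integrable.
rewrite -seg_int_cst //; apply: le_Rintegral => //.
- apply: cont_on_integrable => x xab.
  by apply: continuous_comp; [exact: cf | exact: norm_continuous].
- by apply: cont_on_integrable => x _; exact: cst_continuous.
Qed.

Lemma seg_int_cat a b c f : a <= c -> c <= b -> cont_on a b f ->
  seg_int a b f = seg_int a c f + seg_int c b f.
Proof.
move=> ac cb cf; apply/eqP; rewrite addrC -subr_eq; apply/eqP.
rewrite /seg_int Rintegral_itvB ?bnd_simp //; last exact: cont_on_integrable.
rewrite Rintegral_itv_obnd_cbnd //.
apply: integrableS (cont_on_integrable cf) => //.
by apply: subset_itv; rewrite bnd_simp.
Qed.

End SegmentIntegral.

Section Goursat.
Variable R : realType.
Implicit Types (a b c d l m x y : R).

(** The left ends increase and each of them lies below every right end, so their supremum belongs to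
    all the segments. *)
Lemma nested_segments (x : nat -> R) l : 0 <= l ->
  (forall n, x n <= x n.+1 /\ x n.+1 + l / 2 ^+ n.+1 <= x n + l / 2 ^+ n) ->
  exists z, forall n, x n <= z <= x n + l / 2 ^+ n.
Proof.
move=> l0 hx.
have up n k : x n <= x (n + k)%N.
  by elim: k => [|k ih]; rewrite ?addn0 // addnS (le_trans ih) //; case: (hx (n + k)%N).
have dn n k : x (n + k)%N + l / 2 ^+ (n + k) <= x n + l / 2 ^+ n.
  by elim: k => [|k ih]; rewrite ?addn0 // addnS (le_trans _ ih) //; case: (hx (n + k)%N).
have pos n : 0 <= l / 2 ^+ n by rewrite divr_ge0 // exprn_ge0.
have xub n k : x k <= x n + l / 2 ^+ n.
  apply: (@le_trans _ _ (x (n + k)%N)); first by rewrite addnC.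
  by apply: le_trans (dn n k); rewrite lerDl.
exists (sup (range x)) => n; apply/andP; split.
  apply: ub_le_sup; last by exists n.
  by exists (x 0 + l / 2 ^+ 0) => _ [k _ <-].
by apply: ge_sup; [exists (x 0); exists 0%N | move=> _ [k _ <-]].
Qed.

(* Cousin's lemma for the subdivision of a rectangle into four quarters; the
   arguments of [P] are the lower left corner and the sides. *)
Lemma quartering_induction (P : R -> R -> R -> R -> Prop) a l c m :
  0 <= l -> 0 <= m ->
  (forall a' l' c' m', 0 <= l' -> 0 <= m' ->
     a <= a' -> a' + l' <= a + l -> c <= c' -> c' + m' <= c + m ->
     (forall s t : bool, P (a' + s%:R * (l' / 2)) (l' / 2)
                           (c' + t%:R * (m' / 2)) (m' / 2)) ->
     P a' l' c' m') ->
  (forall x y, a <= x <= a + l -> c <= y <= c + m ->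
     exists2 e, 0 < e & forall a' l' c' m', 0 <= l' -> 0 <= m' ->
     a <= a' -> a' + l' <= a + l -> c <= c' -> c' + m' <= c + m ->
     a' <= x <= a' + l' -> c' <= y <= c' + m' -> l' < e -> m' < e ->
     P a' l' c' m') ->
  P a l c m.
Proof.
move=> l0 m0 quarter loc; apply: contrapT => nP.
pose L n := l / 2 ^+ n; pose M n := m / 2 ^+ n.
have LS n : L n.+1 = L n / 2 by rewrite /L exprS invfM mulrA mulrAC.
have MS n : M n.+1 = M n / 2 by rewrite /M exprS invfM mulrA mulrAC.
have L0 n : 0 <= L n by rewrite divr_ge0 // exprn_ge0.
have M0 n : 0 <= M n by rewrite divr_ge0 // exprn_ge0.
pose bad (u : R * R) n := [/\ a <= u.1, u.1 + L n <= a + l, c <= u.2,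
  u.2 + M n <= c + m & ~ P u.1 (L n) u.2 (M n)].
(* The existential stands outside the implication so that [choice] returns a total map; its value at
   a pair that is not bad is irrelevant. *)
have step (un : (R * R) * nat) : exists v : R * R, bad un.1 un.2 ->
    bad v un.2.+1 /\
    [/\ un.1.1 <= v.1, v.1 + L un.2.+1 <= un.1.1 + L un.2,
        un.1.2 <= v.2 & v.2 + M un.2.+1 <= un.1.2 + M un.2].
  have [[]|nb] := pselect (bad un.1 un.2); last by exists un.1.
  case: un => -[x y] n /= h1 h2 h3 h4 h5.
  have [s [t st]] : exists s t : bool, ~ P (x + s%:R * (L n / 2)) (L n / 2)
                           (y + t%:R * (M n / 2)) (M n / 2).
    apply: contrapT => h; apply: h5; apply: quarter => // s t.
    by apply: contrapT => h'; apply: h; exists s, t.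
  exists (x + s%:R * (L n / 2), y + t%:R * (M n / 2)) => _.
  have := L0 n; have := M0 n; rewrite /bad /= !LS !MS => Mn Ln; clear -Mn Ln h1 h2 h3 h4 st.
  by split; split => //; case: s {st}; case: t => /=; lra.
have [next hnext] := choice step.
pose u := fix u n := if n is k.+1 then next (u k, k) else (a, c).
have ubad n : bad (u n) n.
  elim: n => [|n ih] /=; last by case: (hnext (u n, n) ih).
  by rewrite /bad /L /M /= expr0 !divr1.
have unext n := (hnext (u n, n) (ubad n)).2.
have [|x hx] := @nested_segments (fun n => (u n).1) l l0.
  by move=> n; case: (unext n).
have [|y hy] := @nested_segments (fun n => (u n).2) m m0.
  by move=> n; case: (unext n).
have x0 : a <= x <= a + l by have := hx 0%N; rewrite /= expr0 divr1.
have y0 : c <= y <= c + m by have := hy 0%N; rewrite /= expr0 divr1.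
have [e e0 he] := loc x y x0 y0.
(* The summand 1 keeps the divisor positive when the rectangle is a point; at rank n both sides are
   then shorter than e. *)
have lm0 : 0 < l + m + 1 by lra.
have d0 : 0 < e / (l + m + 1) by rewrite divr_gt0.
have [n _ /(_ n (leqnn n))/=] := near_infty_natSinv_expn_lt (PosNum d0).
rewrite /= ltr_pdivlMr // => hn.
have i0 : 0 <= 1 / 2 ^+ n :> R by rewrite divr_ge0 // exprn_ge0.
case: (ubad n) => h1 h2 h3 h4; apply; apply: he => //.
- by rewrite /L -[l]mulr1 -mulrA; apply: le_lt_trans hn; rewrite mulrC ler_wpM2l //; lra.
- by rewrite /M -[m]mulr1 -mulrA; apply: le_lt_trans hn; rewrite mulrC ler_wpM2l //; lra.
Qed.

Lemma seg_int_approx (f g : R -> R) a b k e : a <= b ->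
  cont_on a b f -> cont_on a b g ->
  (forall x, a <= x <= b -> `|f x - g x - k| <= e) ->
  `|seg_int a b f - seg_int a b g - k * (b - a)| <= e * (b - a).
Proof.
move=> ab cf cg h.
have ck : cont_on a b (fun=> k) by move=> x _; exact: cst_continuous.
have cfg : cont_on a b (fun x => f x - g x).
  by move=> x xab; apply: continuousB; [exact: cf | exact: cg].
rewrite -seg_intB // -seg_int_cst // -seg_intB //; apply: le_seg_int => //.
by move=> x xab; apply: continuousB; [exact: cfg | exact: ck].
Qed.

(* Goursat's form of Green's theorem: [A] and [B] are only required to have the
   expansions of a closed form [A dy + B dx] at each point, with no continuity
   of the partial derivatives. *)
Lemma goursat (A B : R -> R -> R) a b c d : a <= b -> c <= d ->
  (forall x, a <= x <= b -> cont_on c d (A x)) ->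
  (forall y, c <= y <= d -> cont_on a b (B ^~ y)) ->
  (forall x y, a <= x <= b -> c <= y <= d -> exists alpha beta D,
    [/\ cont_on c d alpha, cont_on a b beta &
     forall e, 0 < e -> exists2 delta, 0 < delta &
     forall x' y', a <= x' <= b -> c <= y' <= d ->
       `|x' - x| < delta -> `|y' - y| < delta ->
       `|A x' y' - alpha y' - (x' - x) * D| <= e * (`|x' - x| + `|y' - y|) /\
       `|B x' y' - beta x' - (y' - y) * D| <= e * (`|x' - x| + `|y' - y|)]) ->
  seg_int c d (A b) - seg_int c d (A a) =
  seg_int a b (B ^~ d) - seg_int a b (B ^~ c).
Proof.
move=> ab cd cA cB loc.
pose Phi a' l c' m := seg_int c' (c' + m) (A (a' + l)) - seg_int c' (c' + m) (A a')
  - (seg_int a' (a' + l) (B ^~ (c' + m)) - seg_int a' (a' + l) (B ^~ c')).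
(* The bound is homogeneous of degree 2 in the sides, so the bounds for the four quarters add up to
   the bound for the rectangle. *)
have main e : 0 < e -> `|Phi a (b - a) c (d - c)| <= e * (b - a + (d - c)) ^+ 2.
  move=> e0; apply: (@quartering_induction
    (fun a' l c' m => `|Phi a' l c' m| <= e * (l + m) ^+ 2)); rewrite ?subr_ge0 //;
    rewrite !subrKC.
    move=> a' l c' m l0 m0 aa' lb cc' md h.
    have := h false false; have := h false true.
    have := h true false; have := h true true.
    rewrite /Phi !mul0r !addr0 !mul1r -!addrA -!splitr {h}.
    have cA' x : a' <= x <= a' + l -> cont_on c' (c' + m) (A x).
      by move=> ?; apply: cont_on_sub (cA x _) => //; lra.
    have cB' y : c' <= y <= c' + m -> cont_on a' (a' + l) (B ^~ y).
      by move=> ?; apply: cont_on_sub (cB y _) => //; lra.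
    rewrite (@seg_int_cat _ c' (c' + m) (c' + m / 2) (A (a' + l)));
      [|lra|lra|by apply: cA'; lra].
    rewrite (@seg_int_cat _ c' (c' + m) (c' + m / 2) (A a'));
      [|lra|lra|by apply: cA'; lra].
    rewrite (@seg_int_cat _ a' (a' + l) (a' + l / 2) (B ^~ (c' + m)));
      [|lra|lra|by apply: cB'; lra].
    rewrite (@seg_int_cat _ a' (a' + l) (a' + l / 2) (B ^~ c'));
      [|lra|lra|by apply: cB'; lra].
    have -> : e * (l / 2 + m / 2) ^+ 2 = e * (l + m) ^+ 2 / 4 by field.
    move: (e * _) => E; do !move: (seg_int _ _ _) => ?; clear.
    by rewrite !ler_norml => h1 h2 h3 h4; apply/andP; lra.
  move=> x y xab ycd.
  have [al [be [D [cal cbe hD]]]] := loc x y xab ycd.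
  (* Each vertical side contributes an error e/4 (l + m) m and each horizontal one e/4 (l + m) l;
     the four together stay below half of the allowed e (l + m)^2. *)
  have e4 : 0 < e / 4 by lra.
  have [del del0 hdel] := hD _ e4; exists del => //.
  move=> a' l c' m l0 m0 aa' lb cc' md xa' yc' ld md'.
  have inx x' : a' <= x' <= a' + l -> a <= x' <= b by clear -aa' lb; lra.
  have iny y' : c' <= y' <= c' + m -> c <= y' <= d by clear -cc' md; lra.
  have nearx x' : a' <= x' <= a' + l -> `|x' - x| <= l.
    by clear -xa'; rewrite ler_norml; lra.
  have neary y' : c' <= y' <= c' + m -> `|y' - y| <= m.
    by clear -yc'; rewrite ler_norml; lra.
  have e40 := ltW e4.
  have hA x' : a' <= x' <= a' + l -> `|seg_int c' (c' + m) (A x') -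
      seg_int c' (c' + m) al - (x' - x) * D * m| <= e / 4 * (l + m) * m.
    move=> x'a; have := @seg_int_approx (A x') al c' (c' + m) ((x' - x) * D)
        (e / 4 * (l + m)).
    rewrite [c' + m - c']addrC addKr; apply.
    - by rewrite lerDl.
    - exact: cont_on_sub cc' md (cA x' (inx x' x'a)).
    - exact: cont_on_sub cc' md cal.
    move=> y' y'c; have [xl yl] := (nearx x' x'a, neary y' y'c).
    have [+ _] := hdel x' y' (inx x' x'a) (iny y' y'c) (le_lt_trans xl ld)
      (le_lt_trans yl md').
    by move/le_trans; apply; rewrite ler_wpM2l // lerD.
  have hB y' : c' <= y' <= c' + m -> `|seg_int a' (a' + l) (B ^~ y') -
      seg_int a' (a' + l) be - (y' - y) * D * l| <= e / 4 * (l + m) * l.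
    move=> y'c; have := @seg_int_approx (B ^~ y') be a' (a' + l) ((y' - y) * D)
        (e / 4 * (l + m)).
    rewrite [a' + l - a']addrC addKr; apply.
    - by rewrite lerDl.
    - exact: cont_on_sub aa' lb (cB y' (iny y' y'c)).
    - exact: cont_on_sub aa' lb cbe.
    move=> x' x'a; have [xl yl] := (nearx x' x'a, neary y' y'c).
    have [_ +] := hdel x' y' (inx x' x'a) (iny y' y'c) (le_lt_trans xl ld)
      (le_lt_trans yl md').
    by move/le_trans; apply; rewrite ler_wpM2l // lerD.
  have al0 : a' <= a' <= a' + l by rewrite lexx lerDl.
  have al1 : a' <= a' + l <= a' + l by rewrite lexx lerDl l0.
  have cm0 : c' <= c' <= c' + m by rewrite lexx lerDl.
  have cm1 : c' <= c' + m <= c' + m by rewrite lexx lerDl m0.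
  (* Between opposite sides the integrals of [al] and [be] cancel, and both linear terms leave l m
     D: this is where a common [D] for [A] and [B] is used. *)
  move: (hA _ al1) (hA _ al0) (hB _ cm1) (hB _ cm0).
  have -> : e * (l + m) ^+ 2 = 2 * (e / 4 * (l + m) * m) + 2 * (e / 4 * (l + m) * l)
     + e / 2 * (l + m) ^+ 2 by field.
  have : 0 <= e / 2 * (l + m) ^+ 2 by rewrite mulr_ge0 ?sqr_ge0 ?divr_ge0 ?(ltW e0).
  rewrite /Phi; move: (e / 4 * _ * m) (e / 4 * _ * l) (e / 2 * _) => E F G G0.
  do !move: (seg_int _ _ _) => ?; clear -G0.
  by rewrite !ler_norml => h1 h2 h3 h4; apply/andP; lra.
have : Phi a (b - a) c (d - c) = 0.
  apply/eqP; rewrite -normr_le0; apply/ler_addgt0Pl => e e0; rewrite addr0.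
  set s := b - a + (d - c).
  have s1 : 0 < s ^+ 2 + 1 by rewrite ltr_wpDl ?sqr_ge0.
  have := main (e / (s ^+ 2 + 1)) (divr_gt0 e0 s1) => /le_trans; apply.
  by rewrite -mulrA ger_pMr // ler_pdivrMl // mulr1 lerDl.
by rewrite /Phi !subrKC => /eqP; rewrite subr_eq0 => /eqP.
Qed.

End Goursat.

(** * The modulus and the integral of quaternions *)

Section QuaternionModulus.
Variable R : realType.
Implicit Types (p q I J : quat R) (k : R) (w : R * R).

Definition quatE := (@quat_coordE R, qRe1, qI1, qJ1, qK1).

Lemma quat_scaleAl k p q : k *: p * q = k *: (p * q).
Proof. by rewrite !quat_mulE; apply: quat_ext; rewrite /qmul !quatE; ring. Qed.

Lemma quat_scaleAr k p q : p * (k *: q) = k *: (p * q).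
Proof. by rewrite !quat_mulE; apply: quat_ext; rewrite /qmul !quatE; ring. Qed.

Lemma qabs_sqr p : qabs p ^+ 2 = qRe p ^+ 2 + qI p ^+ 2 + qJ p ^+ 2 + qK p ^+ 2.
Proof. by rewrite sqr_sqrtr // !addr_ge0 ?sqr_ge0. Qed.

Lemma qabsM p q : qabs (p * q) = qabs p * qabs q.
Proof.
rewrite /qabs -sqrtrM; last by rewrite !addr_ge0 ?sqr_ge0.
by congr Num.sqrt; rewrite quat_mulE /qmul !quatE; ring.
Qed.

Lemma qabsZ k p : qabs (k *: p) = `|k| * qabs p.
Proof.
rewrite /qabs -sqrtr_sqr -sqrtrM ?sqr_ge0 //.
by congr Num.sqrt; rewrite !quatE; ring.
Qed.

Lemma qabs1 : qabs (1 : quat R) = 1.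
Proof. by rewrite /qabs !quatE expr0n expr1n /= !addr0 sqrtr1. Qed.

Lemma qabsX p n : qabs (p ^+ n) = qabs p ^+ n.
Proof. by elim: n => [|n ih]; rewrite ?expr0 ?qabs1 // !exprS qabsM ih. Qed.

Lemma qabs_distC p q : qabs (p - q) = qabs (q - p).
Proof. by rewrite -qabsN opprB. Qed.

Lemma qabs_triangleB p q : qabs (p - q) <= qabs p + qabs q.
Proof. by rewrite -[qabs q]qabsN qabs_triangle. Qed.

Lemma qabs_coord p :
  [/\ `|qRe p| <= qabs p, `|qI p| <= qabs p, `|qJ p| <= qabs p & `|qK p| <= qabs p].
Proof.
have sq (u : R) : 0 <= u ^+ 2 by exact: sqr_ge0.
move: (sq (qRe p)) (sq (qI p)) (sq (qJ p)) (sq (qK p)) => h0 h1 h2 h3.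
by split; rewrite -sqrtr_sqr; apply: ler_wsqrtr; lra.
Qed.

Lemma norm_ord4_le p k : 0 <= k ->
  (`|p| <= k) = [&& `|qRe p| <= k, `|qI p| <= k, `|qJ p| <= k & `|qK p| <= k].
Proof.
move=> k0; rewrite [`|p|]/Num.norm /= mx_normrE.
apply/bigmax_leP/and4P => [[_ h]|[h0 h1 h2 h3]].
  by split; [apply: (h (0, Ordinal (isT : (0 < 4)%N)))
   |apply: (h (0, Ordinal (isT : (1 < 4)%N)))
   |apply: (h (0, Ordinal (isT : (2 < 4)%N)))
   |apply: (h (0, Ordinal (isT : (3 < 4)%N)))].
split=> // -[i j] _ /=; rewrite ord1.
case: j => -[|[|[|[|n]]]] hn //.
- by rewrite (_ : Ordinal hn = Ordinal (isT : (0 < 4)%N)) //; apply: val_inj.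
- by rewrite (_ : Ordinal hn = Ordinal (isT : (1 < 4)%N)) //; apply: val_inj.
- by rewrite (_ : Ordinal hn = Ordinal (isT : (2 < 4)%N)) //; apply: val_inj.
- by rewrite (_ : Ordinal hn = Ordinal (isT : (3 < 4)%N)) //; apply: val_inj.
Qed.

Lemma norm_le_qabs p : `|p| <= qabs p.
Proof.
rewrite norm_ord4_le ?qabs_ge0 //; apply/and4P; have [*] := qabs_coord p; split => //.
Qed.

(** The constant 2 is the square root of the number of coordinates. With [norm_le_qabs] this makes
    the modulus and the sup norm equivalent, so limits can be handled with the modulus. *)
Lemma qabs_le2 p k : 0 <= k -> `|qRe p| <= k -> `|qI p| <= k -> `|qJ p| <= k ->
  `|qK p| <= k -> qabs p <= 2 * k.
Proof.
move=> k0 h0 h1 h2 h3; have k20 : 0 <= 2 * k by lra.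
rewrite -(ger0_norm k20) -sqrtr_sqr; apply: ler_wsqrtr.
have sq (u : R) : `|u| <= k -> u ^+ 2 <= k ^+ 2.
  by move=> uk; rewrite -[u ^+ 2]real_normK ?num_real // lerXn2r ?nnegrE.
by move: (sq _ h0) (sq _ h1) (sq _ h2) (sq _ h3); rewrite exprMn; lra.
Qed.

Lemma qabs_le_norm p : qabs p <= 2 * `|p|.
Proof.
have : `|p| <= `|p| by [].
by rewrite norm_ord4_le // => /and4P[*]; apply: qabs_le2.
Qed.

Lemma cvg_qabsP (T : Type) (F : set_system T) (FF : Filter F) (h : T -> quat R)
    (l : quat R) :
  h @ F --> l <-> forall e, 0 < e -> \forall x \near F, qabs (h x - l) < e.
Proof.
split=> [/cvgrPdist_lt hl e e0|hl].
  have e2 : 0 < e / 2 by lra.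
  apply: filterS (hl _ e2) => x; rewrite distrC.
  by have := qabs_le_norm (h x - l); lra.
apply/cvgrPdist_lt => e e0; apply: filterS (hl _ e0) => x.
by rewrite distrC; apply: le_lt_trans; exact: norm_le_qabs.
Qed.

Lemma cvg_quat (T : Type) (F : set_system T) (FF : Filter F) (h : T -> quat R)
    (l : quat R) :
  (@qRe R \o h) @ F --> qRe l -> (@qI R \o h) @ F --> qI l ->
  (@qJ R \o h) @ F --> qJ l -> (@qK R \o h) @ F --> qK l -> h @ F --> l.
Proof.
move=> /cvgrPdist_le h0 /cvgrPdist_le h1 /cvgrPdist_le h2 /cvgrPdist_le h3.
apply/cvgrPdist_le => e e0.
near=> x; rewrite norm_ord4_le ?(ltW e0) // !quatE.
by apply/and4P; split; near: x; [exact: h0|exact: h1|exact: h2|exact: h3].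
Unshelve. all: by end_near. Qed.

Lemma qRe_continuous : continuous (@qRe R : quat R -> R).
Proof. exact: coord_continuous. Qed.
Lemma qI_continuous : continuous (@qI R : quat R -> R).
Proof. exact: coord_continuous. Qed.
Lemma qJ_continuous : continuous (@qJ R : quat R -> R).
Proof. exact: coord_continuous. Qed.
Lemma qK_continuous : continuous (@qK R : quat R -> R).
Proof. exact: coord_continuous. Qed.

Lemma cvg_quatM (T : Type) (F : set_system T) (FF : Filter F) (h k : T -> quat R)
    (l m : quat R) :
  h @ F --> l -> k @ F --> m -> (fun x => h x * k x) @ F --> l * m.
Proof.
move=> hl km.
have h0 := cvg_comp _ _ hl (@qRe_continuous l).
have h1 := cvg_comp _ _ hl (@qI_continuous l).
have h2 := cvg_comp _ _ hl (@qJ_continuous l).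
have h3 := cvg_comp _ _ hl (@qK_continuous l).
have k0 := cvg_comp _ _ km (@qRe_continuous m).
have k1 := cvg_comp _ _ km (@qI_continuous m).
have k2 := cvg_comp _ _ km (@qJ_continuous m).
have k3 := cvg_comp _ _ km (@qK_continuous m).
apply: cvg_quat; rewrite /comp quat_mulE /qmul ?quatE;
  under eq_fun do rewrite quat_mulE /qmul ?quatE.
- exact: cvgB (cvgB (cvgB (cvgM h0 k0) (cvgM h1 k1)) (cvgM h2 k2)) (cvgM h3 k3).
- exact: cvgB (cvgD (cvgD (cvgM h0 k1) (cvgM h1 k0)) (cvgM h2 k3)) (cvgM h3 k2).
- exact: cvgD (cvgD (cvgB (cvgM h0 k2) (cvgM h1 k3)) (cvgM h2 k0)) (cvgM h3 k1).
- exact: cvgD (cvgB (cvgD (cvgM h0 k3) (cvgM h1 k2)) (cvgM h2 k1)) (cvgM h3 k0).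
Qed.

Lemma sphereS_sqr J : sphereS J -> J * J = -1.
Proof. by rewrite /sphereS /= expr2. Qed.

Lemma sphereS_coord J : sphereS J -> qRe J = 0 /\ qI J ^+ 2 + qJ J ^+ 2 + qK J ^+ 2 = 1.
Proof.
move=> SJ; have J0 := sphereS_Re SJ; split=> //.
move: (sphereS_sqr SJ) => /(congr1 (@qRe R)).
by rewrite quat_mulE /qmul !quatE J0; lra.
Qed.

Lemma qabs_slice J w : sphereS J -> qabs (slice_pt J w) = Num.sqrt (w.1 ^+ 2 + w.2 ^+ 2).
Proof.
move=> /sphereS_coord[J0 J1]; rewrite /qabs /slice_pt; congr Num.sqrt.
rewrite !quatE J0.
transitivity (w.1 ^+ 2 + w.2 ^+ 2 * (qI J ^+ 2 + qJ J ^+ 2 + qK J ^+ 2)); first by ring.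
by rewrite J1 mulr1.
Qed.

(** Complex multiplication in real coordinates: through it each [slice_pt J] is a copy of the
    complex field, and the commutativity of a line is inherited from it. *)
Definition cmul (z w : R * R) : R * R := (z.1 * w.1 - z.2 * w.2, z.1 * w.2 + z.2 * w.1).

Lemma slice_ptM J z w : sphereS J ->
  slice_pt J (cmul z w) = slice_pt J z * slice_pt J w.
Proof.
move=> SJ; rewrite /slice_pt /cmul /= mulrDl !mulrDr !(quat_scaleAl, quat_scaleAr).
rewrite mulr1 mul1r sphereS_sqr // !scalerA !scalerN mulr1 scalerBl scalerDl.
by rewrite -!addrA; congr (_ + _); rewrite addrC -!addrA.
Qed.

End QuaternionModulus.

Section QuaternionIntegral.
Variable R : realType.
Implicit Types (a b c d k : R) (f g : R -> quat R) (p q : quat R).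

Definition quat_int a b f : quat R :=
  mkquat (seg_int a b (fun x => qRe (f x))) (seg_int a b (fun x => qI (f x)))
         (seg_int a b (fun x => qJ (f x))) (seg_int a b (fun x => qK (f x))).

Lemma cont_on_coord a b f : cont_on a b f ->
  [/\ cont_on a b (fun x => qRe (f x)), cont_on a b (fun x => qI (f x)),
      cont_on a b (fun x => qJ (f x)) & cont_on a b (fun x => qK (f x))].
Proof.
move=> cf; split=> x xab; (apply: continuous_comp; first exact: cf).
- exact: qRe_continuous.
- exact: qI_continuous.
- exact: qJ_continuous.
- exact: qK_continuous.
Qed.

Lemma cont_on_quatM a b f g : cont_on a b f -> cont_on a b g ->
  cont_on a b (fun x => f x * g x).
Proof. by move=> cf cg x xab; apply: cvg_quatM; [exact: cf | exact: cg]. Qed.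

Lemma cont_on_cst (V : topologicalType) a b (v : V) : cont_on a b (fun=> v).
Proof. by move=> x _; exact: cst_continuous. Qed.

Lemma cont_onD a b f g : cont_on a b f -> cont_on a b g ->
  cont_on a b (fun x => f x + g x).
Proof. by move=> cf cg x xab; apply: continuousD; [exact: cf | exact: cg]. Qed.

Lemma cont_onB a b f g : cont_on a b f -> cont_on a b g ->
  cont_on a b (fun x => f x - g x).
Proof. by move=> cf cg x xab; apply: continuousB; [exact: cf | exact: cg]. Qed.

Lemma eq_quat_int a b f g : (forall x, a <= x <= b -> f x = g x) ->
  quat_int a b f = quat_int a b g.
Proof.
move=> fg; rewrite /quat_int; congr mkquat;
  by apply: eq_seg_int => x /fg ->.
Qed.

Lemma quat_int_cst a b p : a <= b -> quat_int a b (fun=> p) = (b - a) *: p.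
Proof.
by move=> ab; apply: quat_ext; rewrite !quatE seg_int_cst // mulrC.
Qed.

Lemma quat_intD a b f g : cont_on a b f -> cont_on a b g ->
  quat_int a b (fun x => f x + g x) = quat_int a b f + quat_int a b g.
Proof.
move=> /cont_on_coord[f0 f1 f2 f3] /cont_on_coord[g0 g1 g2 g3].
apply: quat_ext; rewrite !quatE -seg_intD //;
  by apply: eq_seg_int => x _; rewrite quatE.
Qed.

Lemma quat_intB a b f g : cont_on a b f -> cont_on a b g ->
  quat_int a b (fun x => f x - g x) = quat_int a b f - quat_int a b g.
Proof.
move=> /cont_on_coord[f0 f1 f2 f3] /cont_on_coord[g0 g1 g2 g3].
apply: quat_ext; rewrite !quatE -seg_intB //;
  by apply: eq_seg_int => x _; rewrite !quatE.
Qed.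

(** Each coordinate of a product with a constant quaternion is such a combination of four
    coordinates, which is how constants leave the integral on either side. *)
Lemma seg_int_lin4 a b (f0 f1 f2 f3 : R -> R) (c0 c1 c2 c3 : R) :
  cont_on a b f0 -> cont_on a b f1 -> cont_on a b f2 -> cont_on a b f3 ->
  seg_int a b (fun x => c0 * f0 x + c1 * f1 x + c2 * f2 x + c3 * f3 x) =
  c0 * seg_int a b f0 + c1 * seg_int a b f1 + c2 * seg_int a b f2 +
  c3 * seg_int a b f3.
Proof.
move=> h0 h1 h2 h3.
have cZ (r : R) (h : R -> R) : cont_on a b h -> cont_on a b (fun x => r * h x).
  move=> ch x xab; apply: (@continuousM _ _ (fun=> r) h); last exact: ch.
  exact: cst_continuous.
have cD (h h' : R -> R) : cont_on a b h -> cont_on a b h' ->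
    cont_on a b (fun x => h x + h' x).
  by move=> ch ch' x xab; apply: continuousD; [exact: ch | exact: ch'].
have [k0 k1 k2 k3] := And4 (cZ c0 _ h0) (cZ c1 _ h1) (cZ c2 _ h2) (cZ c3 _ h3).
rewrite (seg_intD (cD _ _ (cD _ _ k0 k1) k2) k3).
by rewrite (seg_intD (cD _ _ k0 k1) k2) (seg_intD k0 k1) !seg_intZ.
Qed.

Lemma quat_intMl a b p f : cont_on a b f ->
  quat_int a b (fun x => p * f x) = p * quat_int a b f.
Proof.
move=> /cont_on_coord[f0 f1 f2 f3]; apply: quat_ext;
  rewrite [in RHS]quat_mulE /qmul !quatE -?mulNr -seg_int_lin4 //;
  by apply: eq_seg_int => x _; rewrite quat_mulE /qmul !quatE; ring.
Qed.

Lemma quat_intMr a b p f : cont_on a b f ->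
  quat_int a b (fun x => f x * p) = quat_int a b f * p.
Proof.
move=> /cont_on_coord[f0 f1 f2 f3]; apply: quat_ext;
  rewrite [in RHS]quat_mulE /qmul !quatE ![seg_int _ _ _ * _]mulrC -?mulNr
    -seg_int_lin4 //;
  by apply: eq_seg_int => x _; rewrite quat_mulE /qmul !quatE; ring.
Qed.

(** The factor 2 is the price of estimating coordinate by coordinate; it is harmless, as the bound
    only serves to show that quantities tend to 0. *)
Lemma le_quat_int a b f k : a <= b -> 0 <= k -> cont_on a b f ->
  (forall x, a <= x <= b -> qabs (f x) <= k) ->
  qabs (quat_int a b f) <= 2 * (k * (b - a)).
Proof.
move=> ab k0 /cont_on_coord[f0 f1 f2 f3] fk.
by apply: qabs_le2; rewrite ?mulr_ge0 ?subr_ge0 // ?quatE; apply: le_seg_int => // x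
   /fk; have [h0 h1 h2 h3] := qabs_coord (f x); apply: le_trans.
Qed.

(** The coordinate maps are real linear, continuous and bounded by the modulus, so they preserve the
    expansions and the real statement applies to each of them. *)
Lemma quat_goursat (A B : R -> R -> quat R) a b c d : a <= b -> c <= d ->
  (forall x, a <= x <= b -> cont_on c d (A x)) ->
  (forall y, c <= y <= d -> cont_on a b (B ^~ y)) ->
  (forall x y, a <= x <= b -> c <= y <= d -> exists alpha beta D,
    [/\ cont_on c d alpha, cont_on a b beta &
     forall e, 0 < e -> exists2 delta, 0 < delta &
     forall x' y', a <= x' <= b -> c <= y' <= d ->
       `|x' - x| < delta -> `|y' - y| < delta ->
       qabs (A x' y' - alpha y' - (x' - x) *: D) <= e * (`|x' - x| + `|y' - y|) /\
       qabs (B x' y' - beta x' - (y' - y) *: D) <= e * (`|x' - x| + `|y' - y|)]) ->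
  quat_int c d (A b) - quat_int c d (A a) =
  quat_int a b (B ^~ d) - quat_int a b (B ^~ c).
Proof.
move=> ab cd cA cB loc.
have gen (T : quat R -> R) : continuous T -> (forall p, `|T p| <= qabs p) ->
    (forall p q, T (p - q) = T p - T q) -> (forall k p, T (k *: p) = k * T p) ->
    seg_int c d (fun y => T (A b y)) - seg_int c d (fun y => T (A a y)) =
    seg_int a b (fun x => T (B x d)) - seg_int a b (fun x => T (B x c)).
  move=> cT leT TB TZ.
  have cTo (u v : R) (f : R -> quat R) : cont_on u v f -> cont_on u v (T \o f).
    by move=> cf x xab; apply: continuous_comp; [exact: cf | exact: cT].
  apply: (@goursat _ (fun x y => T (A x y)) (fun x y => T (B x y))) => //.
  - by move=> x xab; apply: cTo (cA x xab).
  - by move=> y ycd; apply: cTo (cB y ycd).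
  move=> x y xab ycd; have [al [be [D [cal cbe h]]]] := loc x y xab ycd.
  exists (T \o al), (T \o be), (T D); split; [exact: cTo|exact: cTo|].
  move=> e e0; have [del del0 hdel] := h e e0; exists del => // x' y' h1 h2 h3 h4.
  have [hA hB] := hdel x' y' h1 h2 h3 h4; rewrite /= -!TZ -!TB.
  by split; [apply: le_trans hA|apply: le_trans hB].
have hc (p : quat R) := qabs_coord p.
apply: quat_ext; rewrite !quatE; apply: gen; rewrite ?quatE //;
  try (by move=> p; case: (hc p)); try (by move=> *; rewrite !quatE).
- exact: qRe_continuous.
- exact: qI_continuous.
- exact: qJ_continuous.
- exact: qK_continuous.
Qed.


End QuaternionIntegral.

(** * Trigonometric functions and complex lines *)

Section Trigonometry.
Variable R : realType.
Implicit Types (x y a b : R) (n : nat).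

Lemma MVT_unordered (f f' : R -> R) x y :
  (forall t : R, is_derive t (1 : R) f (f' t)) ->
  exists2 t, `|t - x| <= `|y - x| & f y - f x = f' t * (y - x).
Proof.
move=> df.
have cf (u v : R) : {within `[u, v], continuous f}.
  apply: continuous_subspaceT => t.
  by apply: differentiable_continuous; apply/derivable1_diffP; case: (df t).
have [xy|/ltW yx] := leP x y.
  have [t] := MVT_segment xy (fun t _ => df t) (cf _ _).
  rewrite in_itv /= => /andP[xt ty] ->; exists t => //.
  by rewrite !ger0_norm ?subr_ge0 // lerD2r.
have [t] := MVT_segment yx (fun t _ => df t) (cf _ _).
rewrite in_itv /= => /andP[yt tx] e; exists t.
  by rewrite !ler0_norm ?subr_le0 // lerN2 lerD2r.
by rewrite -opprB e -mulrN opprB.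
Qed.

Lemma cos_lipschitz x y : `|cos y - cos x| <= `|y - x|.
Proof.
have [t _ ->] := MVT_unordered x y (fun t => is_derive_cos t).
by rewrite normrM normrN ler_piMl // sin_max.
Qed.

Lemma sin_lipschitz x y : `|sin y - sin x| <= `|y - x|.
Proof.
have [t _ ->] := MVT_unordered x y (fun t => is_derive_sin t).
by rewrite normrM ler_piMl // cos_max.
Qed.

(** The mean value theorem for [cos], then the Lipschitz bound for [sin] at the intermediate point;
    the constant 1 in place of 1/2 is enough. *)
Lemma cos_taylor1 x y : `|cos y - cos x + (y - x) * sin x| <= `|y - x| ^+ 2.
Proof.
have [t tx ->] := MVT_unordered x y (fun t => is_derive_cos t).
rewrite (_ : _ + _ = (sin x - sin t) * (y - x)); last by ring.
rewrite normrM expr2 ler_wpM2r // distrC; apply: le_trans tx; exact: sin_lipschitz.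
Qed.

Lemma sin_taylor1 x y : `|sin y - sin x - (y - x) * cos x| <= `|y - x| ^+ 2.
Proof.
have [t tx ->] := MVT_unordered x y (fun t => is_derive_sin t).
rewrite (_ : _ - _ = (cos t - cos x) * (y - x)); last by ring.
rewrite normrM expr2 ler_wpM2r //; apply: le_trans tx; exact: cos_lipschitz.
Qed.

Lemma seg_int_derive (F f : R -> R) a b : a < b ->
  (forall t : R, is_derive t (1 : R) F (f t)) -> continuous f ->
  seg_int a b f = F b - F a.
Proof.
move=> ab dF cf.
have cF : continuous F.
  move=> t; apply: differentiable_continuous.
  by apply/derivable1_diffP; case: (dF t).
rewrite /seg_int /Rintegral (@continuous_FTC2 _ f F) //.
- exact: continuous_subspaceT.
- split; first by move=> t _; case: (dF t).
  + exact/cvg_at_right_filter/cF.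
  + exact/cvg_at_left_filter/cF.
- by move=> t _; rewrite derive1E; case: (dF t).
Qed.

Lemma cosMn2pi n : cos (n%:R * (pi *+ 2)) = 1 :> R.
Proof. by rewrite mulr_natl -[_ *+ n]add0r (periodicn (@cosD2pi R)) cos0. Qed.

Lemma sinMn2pi n : sin (n%:R * (pi *+ 2)) = 0 :> R.
Proof. by rewrite mulr_natl -[_ *+ n]add0r (periodicn (@sinD2pi R)) sin0. Qed.

Lemma seg_int_cosMn n : (0 < n)%N ->
  seg_int 0 (pi *+ 2) (fun t : R => cos (n%:R * t)) = 0.
Proof.
move=> n0; have nR : n%:R != 0 :> R by rewrite pnatr_eq0 -lt0n.
have dF (t : R) : is_derive t (1 : R) (fun t => n%:R^-1 * sin (n%:R * t))
    (cos (n%:R * t)).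
  by apply: is_derive_eq; rewrite /GRing.scale /= mulr1 mulrCA mulVf ?mulr1.
have pi2 : 0 < pi *+ 2 :> R by rewrite pmulrn_lgt0 ?pi_gt0.
rewrite (seg_int_derive pi2 dF).
  by rewrite sinMn2pi mulr0 mulr0 sin0 mulr0 subr0.
move=> t; apply: continuous_comp; last exact: continuous_cos.
by apply: continuousM; [exact: cst_continuous|].
Qed.

Lemma seg_int_sinMn n : seg_int 0 (pi *+ 2) (fun t : R => sin (n%:R * t)) = 0.
Proof.
have [->|n0] := posnP n.
  rewrite (_ : (fun _ => _) = fun=> 0); last by apply/funext => t; rewrite mul0r sin0.
  by rewrite seg_int_cst ?mul0r // mulrn_wge0 ?pi_ge0.
have nR : n%:R != 0 :> R by rewrite pnatr_eq0 -lt0n.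
have dF (t : R) : is_derive t (1 : R) (fun t => - n%:R^-1 * cos (n%:R * t))
    (sin (n%:R * t)).
  by apply: is_derive_eq; rewrite /GRing.scale /= mulr1; field.
have pi2 : 0 < pi *+ 2 :> R by rewrite pmulrn_lgt0 ?pi_gt0.
rewrite (seg_int_derive pi2 dF).
  by rewrite cosMn2pi mulr0 cos0 subrr.
move=> t; apply: continuous_comp; last exact: continuous_sin.
by apply: continuousM; [exact: cst_continuous|].
Qed.

End Trigonometry.

Section ComplexLine.
Variable R : realType.
Implicit Types (p q I J z : quat R) (k t : R).

Lemma slice_ptD J (u v : R * R) : slice_pt J (u + v) = slice_pt J u + slice_pt J v.
Proof. by rewrite /slice_pt /= !scalerDl addrACA. Qed.

Lemma slice_ptN J (u : R * R) : slice_pt J (- u) = - slice_pt J u.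
Proof. by rewrite /slice_pt /= !scaleNr opprD. Qed.

Lemma slice_ptZ J k (u : R * R) : slice_pt J (k * u.1, k * u.2) = k *: slice_pt J u.
Proof. by rewrite /slice_pt /= scalerDr !scalerA. Qed.

Lemma lineD J p q : complex_line J p -> complex_line J q -> complex_line J (p + q).
Proof. by move=> [u _ <-] [v _ <-]; exists (u + v); rewrite ?slice_ptD. Qed.

Lemma lineN J p : complex_line J p -> complex_line J (- p).
Proof. by move=> [u _ <-]; exists (- u); rewrite ?slice_ptN. Qed.

Lemma lineB J p q : complex_line J p -> complex_line J q -> complex_line J (p - q).
Proof. by move=> hp hq; apply: lineD => //; apply: lineN. Qed.

Lemma lineZ J k p : complex_line J p -> complex_line J (k *: p).
Proof. by move=> [u _ <-]; exists (k * u.1, k * u.2); rewrite ?slice_ptZ. Qed.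

Lemma line_pt J (u : R * R) : complex_line J (slice_pt J u).
Proof. by exists u. Qed.

Lemma line_real J k : complex_line J (k *: (1 : quat R)).
Proof. by exists (k, 0) => //; rewrite /slice_pt /= scale0r addr0. Qed.

Lemma lineM J p q : sphereS J -> complex_line J p -> complex_line J q ->
  complex_line J (p * q).
Proof. by move=> SJ [u _ <-] [v _ <-]; exists (cmul u v); rewrite ?slice_ptM. Qed.

Lemma lineX J p n : sphereS J -> complex_line J p -> complex_line J (p ^+ n).
Proof.
move=> SJ Jp; elim: n => [|n ih]; last by rewrite exprS; apply: lineM.
by rewrite expr0 -[X in complex_line _ X]scale1r; apply: line_real.
Qed.

Lemma line_comm J p q : sphereS J -> complex_line J p -> complex_line J q ->
  p * q = q * p.
Proof.
move=> SJ [u _ <-] [v _ <-]; rewrite -!slice_ptM //; congr slice_pt.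
by rewrite /cmul; congr pair; ring.
Qed.

Definition qconj q : quat R := mkquat (qRe q) (- qI q) (- qJ q) (- qK q).

Lemma line_conj J p : sphereS J -> complex_line J p -> complex_line J (qconj p).
Proof.
move=> SJ [u _ <-]; exists (u.1, - u.2) => //; have J0 := sphereS_Re SJ.
by apply: quat_ext; rewrite /slice_pt /qconj /= !quatE ?J0; ring.
Qed.

Lemma mul_qconj q : q * qconj q = (qabs q ^+ 2) *: (1 : quat R).
Proof.
by apply: quat_ext; rewrite quat_mulE /qmul /qconj qabs_sqr !quatE; ring.
Qed.

Lemma cont_on_qconj a b (h : R -> quat R) : cont_on a b h ->
  cont_on a b (fun x => qconj (h x)).
Proof.
move=> /cont_on_coord[h0 h1 h2 h3] x xab.
by apply: cvg_quat; rewrite /comp /qconj ?quatE; under eq_fun do rewrite !quatE;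
  [exact: h0|apply: cvgN; exact: h1|apply: cvgN; exact: h2|apply: cvgN; exact: h3].
Qed.

Lemma cont_on_scale a b (u : R -> R) (h : R -> quat R) :
  cont_on a b u -> cont_on a b h -> cont_on a b (fun x => u x *: h x).
Proof. by move=> cu ch x xab; apply: cvgZ; [exact: cu | exact: ch]. Qed.

Lemma cont_on_qabs2 a b (h : R -> quat R) : cont_on a b h ->
  cont_on a b (fun x => qabs (h x) ^+ 2).
Proof.
move=> /cont_on_coord[h0 h1 h2 h3] x xab.
rewrite /prop_for /continuous_at qabs_sqr; under eq_fun do rewrite qabs_sqr.
by apply: cvgD; [apply: cvgD; [apply: cvgD|]|];
  apply: cvgM; [exact: h0|exact: h0|exact: h1|exact: h1|
                exact: h2|exact: h2|exact: h3|exact: h3].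
Qed.

(** The exponential e^(J t), given by Euler's formula. *)
Definition uexp J t : quat R := slice_pt J (cos t, sin t).

Lemma uexp_line J t : complex_line J (uexp J t).
Proof. exact: line_pt. Qed.

Lemma qabs_uexp J t : sphereS J -> qabs (uexp J t) = 1.
Proof. by move=> SJ; rewrite qabs_slice //= cos2Dsin2 sqrtr1. Qed.

Lemma uexp0 J : uexp J 0 = 1.
Proof. by rewrite /uexp cos0 sin0 /slice_pt /= scale1r scale0r addr0. Qed.

Lemma uexp2pi J : uexp J (pi *+ 2) = 1.
Proof. by rewrite /uexp cos2pi sin2pi /slice_pt /= scale1r scale0r addr0. Qed.

Lemma uexpD J s t : sphereS J -> uexp J (s + t) = uexp J s * uexp J t.
Proof.
move=> SJ; rewrite -slice_ptM // /uexp cosD sinD; congr slice_pt.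
by rewrite /cmul /=; congr pair; ring.
Qed.

Lemma uexpN J t : sphereS J -> uexp J t * uexp J (- t) = 1.
Proof. by move=> SJ; rewrite -uexpD // subrr uexp0. Qed.

Lemma uexpX J t n : sphereS J -> uexp J t ^+ n = uexp J (n%:R * t).
Proof.
move=> SJ; elim: n => [|n ih]; first by rewrite expr0 mul0r uexp0.
by rewrite exprSr ih -uexpD // -natr1 mulrDl mul1r.
Qed.

Lemma qabs_slice_le J (u : R * R) k : sphereS J -> `|u.1| <= k -> `|u.2| <= k ->
  qabs (slice_pt J u) <= 2 * k.
Proof.
move=> SJ h1 h2; apply: le_trans (qabs_triangle _ _) _.
have [J0 J1] := sphereS_coord SJ.
have -> : 2 * k = k + k by ring.
rewrite !qabsZ qabs1 mulr1 (_ : qabs J = 1) ?mulr1 ?lerD //.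
by rewrite /qabs J0 expr0n /= add0r J1 sqrtr1.
Qed.

Lemma uexp_lipschitz J s t : sphereS J -> qabs (uexp J t - uexp J s) <= 2 * `|t - s|.
Proof.
move=> SJ; rewrite -slice_ptN -slice_ptD; apply: qabs_slice_le => //=.
  exact: cos_lipschitz.
exact: sin_lipschitz.
Qed.

Lemma uexp_taylor1 J s t : sphereS J ->
  qabs (uexp J t - uexp J s - (t - s) *: (J * uexp J s)) <= 2 * `|t - s| ^+ 2.
Proof.
move=> SJ.
have -> : J * uexp J s = slice_pt J (- sin s, cos s).
  transitivity (slice_pt J (0, 1) * uexp J s).
    by rewrite {1}/slice_pt /= scale0r scale1r add0r.
  by rewrite -slice_ptM //; congr slice_pt; rewrite /cmul /=; congr pair; ring.
rewrite -slice_ptZ -!slice_ptN -!slice_ptD; apply: qabs_slice_le => //=.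
  by rewrite mulrN opprK; exact: cos_taylor1.
exact: sin_taylor1.
Qed.

Lemma cont_on_uexp J a b : sphereS J -> cont_on a b (uexp J).
Proof.
move=> SJ x _; apply/cvg_qabsP => e e0.
have e2 : 0 < e / 2 by lra.
near=> t; apply: le_lt_trans (uexp_lipschitz x t SJ) _.
suff : `|t - x| < e / 2 by lra.
by near: t; exists (e / 2) => //= t; rewrite /ball_ /= distrC.
Unshelve. all: by end_near. Qed.

Lemma cont_on_uexpN J a b : sphereS J -> cont_on a b (fun t => uexp J (- t)).
Proof.
move=> SJ x _; apply: (@continuous_comp _ _ _ (fun t => - t) (uexp J)).
  exact: opp_continuous.
by apply: (@cont_on_uexp J (- x) (- x)) => //; rewrite lexx.
Qed.

Lemma quat_int_uexpNX J n : sphereS J ->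
  quat_int 0 (pi *+ 2) (fun t => uexp J (- t) ^+ n) =
  (n == 0%N)%:R * (pi *+ 2) *: (1 : quat R).
Proof.
move=> SJ; have pi0 : 0 <= pi *+ 2 :> R by rewrite mulrn_wge0 ?pi_ge0.
have [->|n0] := eqVneq n 0%N.
  by under eq_quat_int do rewrite expr0; rewrite quat_int_cst // subr0 mul1r.
rewrite mul0r scale0r.
have cc : cont_on 0 (pi *+ 2) (fun t : R => cos (n%:R * t)).
  move=> t _; apply: continuous_comp; last exact: continuous_cos.
  by apply: continuousM; [exact: cst_continuous|].
have cs : cont_on 0 (pi *+ 2) (fun t : R => sin (n%:R * t)).
  move=> t _; apply: continuous_comp; last exact: continuous_sin.
  by apply: continuousM; [exact: cst_continuous|].
(* A coordinate of e^(- n J t) is a combination of a cosine and a sine; two null terms bring it to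
   the shape of [seg_int_lin4]. *)
have key (u v : R) : seg_int 0 (pi *+ 2)
    (fun t : R => u * cos (n%:R * t) + v * sin (n%:R * t) + 0 * cos (n%:R * t)
      + 0 * cos (n%:R * t)) = 0.
  by rewrite seg_int_lin4 // seg_int_cosMn ?lt0n // seg_int_sinMn !mulr0 !addr0.
apply: quat_ext; rewrite !quatE;
  [rewrite -[RHS](key 1 (- qRe J))|rewrite -[RHS](key 0 (- qI J))
  |rewrite -[RHS](key 0 (- qJ J))|rewrite -[RHS](key 0 (- qK J))];
  apply: eq_seg_int => t _;
  by rewrite uexpX // /uexp /slice_pt !quatE mulrN cosN sinN /=; ring.
Qed.

End ComplexLine.

(** * Cauchy formula and Taylor expansion on a complex line *)

Section Cauchy.
Variable R : realType.
Implicit Types (p q I J z c d : quat R) (f : quat R -> quat R).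

(** The complex derivative along the line, with the increment on the left: h -> h * d commutes with
    left multiplication by J, as the Cauchy-Riemann equation with I on the left requires. *)
Definition line_derivative J f q d : Prop := forall e : R, 0 < e ->
  exists2 delta : R, 0 < delta & forall p, complex_line J p ->
    qabs (p - q) < delta ->
    qabs (f p - f q - (p - q) * d) <= e * qabs (p - q).

Lemma line_derivative_continuous J f q d : line_derivative J f q d ->
  forall e : R, 0 < e -> exists2 delta : R, 0 < delta &
    forall p, complex_line J p -> qabs (p - q) < delta -> qabs (f p - f q) < e.
Proof.
move=> fd e e0; have [del del0 h] := fd 1 ltr01.
have M0 : 0 < 1 + qabs d by have := qabs_ge0 d; lra.
exists (Num.min del (e / (1 + qabs d))) => [|p Jp].
  by rewrite lt_min del0 divr_gt0.
rewrite lt_min ltr_pdivlMr // => /andP[pdel pe].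
rewrite -(subrK ((p - q) * d) (f p - f q)).
apply: le_lt_trans (qabs_triangle _ _) _.
apply: le_lt_trans pe; rewrite qabsM mulrDr mulr1 lerD2r.
by have := h p Jp pdel; rewrite mul1r.
Qed.

Lemma cont_on_comp_line J f a b (g : R -> quat R) :
  cont_on a b g -> (forall x, complex_line J (g x)) ->
  (forall x, a <= x <= b -> exists d, line_derivative J f (g x) d) ->
  cont_on a b (f \o g).
Proof.
move=> cg Jg fg x xab; have [d fd] := fg x xab.
apply/cvg_qabsP => e e0; have [del del0 h] := line_derivative_continuous fd e0.
have /cvg_qabsP /(_ _ del0) := cg x xab.
by apply: filterS => y; exact: h.
Qed.

Lemma cont_on_bounded a b (g : R -> quat R) : a <= b -> cont_on a b g ->
  exists2 k, 0 <= k & forall x, a <= x <= b -> qabs (g x) <= k.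
Proof.
move=> ab cg.
have cn : {within `[a, b], continuous (fun x => `|g x|)}.
  apply: cont_on_within => x xab.
  by apply: continuous_comp; [exact: cg|exact: norm_continuous].
have [m _ hm] := EVT_max ab cn.
exists (2 * `|g m|); first by rewrite mulr_ge0.
move=> x xab; apply: le_trans (qabs_le_norm _) _.
by rewrite ler_wpM2l // hm // in_itv.
Qed.

Section Kernel.
Variables (J z : quat R) (rho : R).
Hypotheses (SJ : sphereS J) (Jz : complex_line J z) (zrho : qabs z < rho).

Let rho0 : 0 < rho. Proof. by apply: le_lt_trans zrho; exact: qabs_ge0. Qed.

(** The vector E of the overview, with z = q - c. *)
Definition radius_vec (t : R) : quat R := rho *: uexp J t - z.

(** The quotient E^-1 rho e^(J t), the inverse of E being its conjugate over its squared modulus;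
    [cauchy_kernelE] is the characteristic property. *)
Definition cauchy_kernel (t : R) : quat R :=
  (rho / qabs (radius_vec t) ^+ 2) *: (uexp J t * qconj (radius_vec t)).

Lemma radius_vec_line t : complex_line J (radius_vec t).
Proof. by apply: lineB => //; apply/lineZ/uexp_line. Qed.

Lemma cauchy_kernel_line t : complex_line J (cauchy_kernel t).
Proof.
apply/lineZ/lineM => //; first exact: uexp_line.
by apply: line_conj => //; exact: radius_vec_line.
Qed.

Lemma radius_vec_ge t : rho - qabs z <= qabs (radius_vec t).
Proof.
have := qabs_triangle (radius_vec t) z.
rewrite subrK qabsZ qabs_uexp // mulr1 ger0_norm ?(ltW rho0) //; lra.
Qed.

Lemma radius_vec_le t : qabs (radius_vec t) <= 2 * rho.
Proof.
apply: le_trans (qabs_triangleB _ _) _.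
by rewrite qabsZ qabs_uexp // mulr1 ger0_norm ?(ltW rho0) //; have := zrho; lra.
Qed.

Let rv_gt0 t : 0 < qabs (radius_vec t).
Proof. by apply: lt_le_trans (radius_vec_ge t); rewrite subr_gt0. Qed.

Lemma cauchy_kernelE t : cauchy_kernel t * radius_vec t = rho *: uexp J t.
Proof.
rewrite /cauchy_kernel quat_scaleAl -mulrA.
rewrite (line_comm SJ (line_conj SJ (radius_vec_line t)) (radius_vec_line t)).
rewrite mul_qconj quat_scaleAr mulr1 scalerA divfK //.
by rewrite expf_neq0 // gt_eqF ?rv_gt0.
Qed.

Lemma qabs_cauchy_kernel t : qabs (cauchy_kernel t) <= rho / (rho - qabs z).
Proof.
rewrite ler_pdivlMr ?subr_gt0 //.
have := congr1 (@qabs R) (cauchy_kernelE t).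
rewrite qabsM qabsZ qabs_uexp // mulr1 (ger0_norm (ltW rho0)) => e.
by rewrite -[leRHS]e ler_wpM2l ?qabs_ge0 ?radius_vec_ge.
Qed.

Lemma cont_on_radius_vec a b : cont_on a b radius_vec.
Proof.
apply: cont_onB; last exact: cont_on_cst.
by apply: cont_on_scale; [exact: cont_on_cst | exact: cont_on_uexp].
Qed.

Lemma cont_on_cauchy_kernel a b : cont_on a b cauchy_kernel.
Proof.
apply: cont_on_scale; last first.
  apply: cont_on_quatM; first exact: cont_on_uexp.
  exact/cont_on_qconj/cont_on_radius_vec.
move=> x xab; apply: cvgM; first exact: cvg_cst.
apply: cvgV; first by rewrite expf_neq0 // gt_eqF ?rv_gt0.
by apply: (cont_on_qabs2 (@cont_on_radius_vec a b)).
Qed.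

Lemma radius_vecB s t : radius_vec t - radius_vec s = rho *: (uexp J t - uexp J s).
Proof. by rewrite /radius_vec scalerBr opprB addrA subrK. Qed.

Section Formula.
Variables (f : quat R -> quat R) (c : quat R).
Hypothesis (Jc : complex_line J c).
Hypothesis holf : forall q, complex_line J q -> qabs (q - c) <= rho ->
  exists d, line_derivative J f q d.

Let tau : R := pi *+ 2.
Let tau0 : 0 <= tau. Proof. by rewrite mulrn_wge0 ?pi_ge0. Qed.
(** Contracts the boundary circle (t = 1) to the point c + z (t = 0) along segments, hence inside
    the closed disc by convexity. *)
Let path (t s : R) : quat R := c + z + t *: radius_vec s.

Let path_line t s : complex_line J (path t s).
Proof. by apply: lineD; [exact: lineD|apply/lineZ/radius_vec_line]. Qed.

Let path_disc (t s : R) : 0 <= t <= 1 -> qabs (path t s - c) <= rho.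
Proof.
move=> t01; rewrite /path addrAC [c + z]addrC addrK /radius_vec scalerBr.
rewrite (_ : _ + _ = (1 - t) *: z + t *: (rho *: uexp J s)); last first.
  by rewrite scalerBl scale1r addrCA addrC.
apply: le_trans (qabs_triangle _ _) _; rewrite !qabsZ qabs_uexp // mulr1.
rewrite !ger0_norm ?(ltW rho0) //; try lra.
rewrite [leRHS](_ : _ = (1 - t) * rho + t * rho); last by ring.
by rewrite lerD2r ler_wpM2l ?(ltW zrho) //; lra.
Qed.

(** With w = c + z + t E one has dw (w - c - z)^-1 = dt / t + J rho e^(J s) E^-1 ds; multiplying by
    - J gives these two components. *)
Let form_dtheta (t s : R) : quat R := cauchy_kernel s * f (path t s).
Let form_dt (t s : R) : quat R := - t^-1 *: (J * f (path t s)).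

Let cont_path_theta t a b : cont_on a b (path t).
Proof.
apply: cont_onD; first exact: cont_on_cst.
by apply: cont_on_scale; [exact: cont_on_cst|exact: cont_on_radius_vec].
Qed.

Let cont_dtheta (t a b : R) : 0 <= t <= 1 -> cont_on a b (form_dtheta t).
Proof.
move=> t01; apply: cont_on_quatM; first exact: cont_on_cauchy_kernel.
apply: (@cont_on_comp_line J f _ _ (path t)) => [||s _].
- exact: cont_path_theta.
- exact: path_line.
- by apply: holf => //; exact: path_disc.
Qed.

Let cont_dt (s a : R) : 0 < a -> cont_on a 1 (form_dt ^~ s).
Proof.
move=> a0; apply: cont_on_scale.
  move=> t /andP[ta _]; apply: cvgN; apply: cvgV; last exact: cvg_id.
  by rewrite gt_eqF // (lt_le_trans a0).
apply: cont_on_quatM; first exact: cont_on_cst.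
apply: (@cont_on_comp_line J f _ _ (path ^~ s)) => // [|t t1]; last first.
  by apply: holf => //; apply: path_disc; lra.
apply: cont_onD; first exact: cont_on_cst.
apply: cont_on_scale; last exact: cont_on_cst.
by move=> t _; exact: cvg_id.
Qed.

(** With d the derivative of f at the point, the t-derivative of the first component is (kernel) E d
    = rho e^(J s) d, and the s-derivative of the second is - J t^-1 (t rho J e^(J s)) d, the same
    since J^2 = -1. *)
Let forms_closed (a t0 s0 : R) : 0 < a -> a <= t0 <= 1 -> 0 <= s0 <= tau ->
  exists alpha beta D,
    [/\ cont_on 0 tau alpha, cont_on a 1 beta &
     forall e : R, 0 < e -> exists2 delta : R, 0 < delta &
     forall t s : R, a <= t <= 1 -> 0 <= s <= tau ->
       `|t - t0| < delta -> `|s - s0| < delta ->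
       qabs (form_dtheta t s - alpha s - (t - t0) *: D) <= e * (`|t - t0| + `|s - s0|) /\
       qabs (form_dt t s - beta t - (s - s0) *: D) <= e * (`|t - t0| + `|s - s0|)].
Proof.
move=> a0 t01 s0t.
have t01' : 0 <= t0 <= 1 by lra.
have [d hd] := holf (path_line t0 s0) (path_disc s0 t01').
set q0 := path t0 s0 in hd.
pose C := rho / (rho - qabs z); pose M := qabs d.
have C0 : 0 <= C by rewrite divr_ge0 ?subr_ge0 ?(ltW rho0) ?(ltW zrho).
have M0 : 0 <= M by exact: qabs_ge0.
have rhoge0 := ltW rho0.
(* The components on the lines t = t0 and s = s0, with f replaced by its affine approximation at
   [q0]. *)
exists (fun s => cauchy_kernel s * (f q0 + t0 *: (radius_vec s - radius_vec s0) * d)).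
exists (fun t => - t^-1 *: (J * (f q0 + (t - t0) *: radius_vec s0 * d))).
exists (rho *: (uexp J s0 * d)); split.
- apply: cont_on_quatM; first exact: cont_on_cauchy_kernel.
  apply: cont_onD; first exact: cont_on_cst.
  apply: cont_on_quatM; last exact: cont_on_cst.
  apply: cont_on_scale; first exact: cont_on_cst.
  by apply: cont_onB; [exact: cont_on_radius_vec|exact: cont_on_cst].
- apply: cont_on_scale.
    move=> t /andP[ta _]; apply: cvgN; apply: cvgV; last exact: cvg_id.
    by rewrite gt_eqF // (lt_le_trans a0).
  apply: cont_on_quatM; first exact: cont_on_cst.
  apply: cont_onD; first exact: cont_on_cst.
  apply: cont_on_quatM; last exact: cont_on_cst.
  apply: cont_on_scale; last exact: cont_on_cst.
  by move=> t _; apply: cvgB; [exact: cvg_id|exact: cvg_cst].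
move=> e e0.
have ai0 : 0 < a^-1 by rewrite invr_gt0.
(* Gathers the constants of both estimates: the remainder of f is multiplied by at most C or a^-1,
   and the variation of [uexp J] brings 2 rho M. The summand 1 makes Q positive. *)
pose Q := 2 * rho * (C + a^-1) + 2 * rho * M + 1.
have Q0 : 0 < Q.
  have h1 : 0 <= rho * (C + a^-1) by rewrite mulr_ge0 ?addr_ge0 ?(ltW ai0).
  by have h2 : 0 <= rho * M by [rewrite mulr_ge0]; rewrite /Q; lra.
pose e1 := e / (2 * Q).
have e10 : 0 < e1 by rewrite divr_gt0 // mulr_gt0.
have [del del0 hdel] := hd e1 e10.
(* The displacement is at most 2 rho (|t - t0| + |s - s0|), so del / (4 rho) brings it below [del];
   the bound by [e1] absorbs the terms of second order. *)
exists (Num.min (del / (4 * rho)) e1) => [|t s ta1 st].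
  by rewrite lt_min e10 andbT divr_gt0 // mulr_gt0.
rewrite !lt_min => /andP[tdel te1] /andP[sdel se1].
have t1 : 0 < t by lra.
have t1' : 0 <= t <= 1 by lra.
set S := `|t - t0| + `|s - s0|.
have S0 : 0 <= S by rewrite addr_ge0.
have tS : `|t - t0| <= S by rewrite lerDl.
have sS : `|s - s0| <= S by rewrite lerDr.
pose D := path t s - q0.
have DE : D = t *: radius_vec s - t0 *: radius_vec s0.
  by rewrite /D /q0 /path opprD addrACA subrr add0r.
(* Two routes around the rectangle. In the first the increment in t is along [radius_vec s], which
   the kernel at s simplifies; in the second the increment in s carries the factor t, which t^-1
   cancels. *)
have DE1 : D = (t - t0) *: radius_vec s + t0 *: (radius_vec s - radius_vec s0).
  rewrite DE; move: (radius_vec s) (radius_vec s0) => u v.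
  by rewrite scalerBl scalerBr subrKA.
have DE2 : D = (t - t0) *: radius_vec s0 + t *: (radius_vec s - radius_vec s0).
  rewrite DE; move: (radius_vec s) (radius_vec s0) => u v.
  by rewrite scalerBl scalerBr [RHS]addrC subrKA.
have Dle : qabs D <= 2 * rho * S.
  rewrite DE1; apply: le_trans (qabs_triangle _ _) _.
  have -> : 2 * rho * S = `|t - t0| * (2 * rho) + 1 * (rho * (2 * `|s - s0|)).
    by rewrite /S; ring.
  apply: lerD; first by rewrite qabsZ ler_wpM2l // radius_vec_le.
  have [t00 t01''] := andP t01'.
  rewrite radius_vecB !qabsZ (ger0_norm t00) (ger0_norm rhoge0).
  by apply: ler_pM => //; rewrite ?mulr_ge0 ?qabs_ge0 // ler_wpM2l // uexp_lipschitz.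
have Ddel : qabs D < del.
  apply: le_lt_trans Dle _; move: tdel sdel; rewrite !ltr_pdivlMr ?mulr_gt0 //.
  by rewrite /S; lra.
have o_le : qabs (f (path t s) - f q0 - D * d) <= e1 * (2 * rho * S).
  apply: le_trans (hdel _ (path_line t s) Ddel) _.
  by rewrite ler_wpM2l // ltW.
have tail : 2 * rho * M * `|s - s0| * S <= 2 * rho * M * e1 * S.
  rewrite ler_wpM2r // ler_wpM2l ?(ltW se1) // mulr_ge0 // mulr_ge0 //.
have Qe : (2 * rho * (C + a^-1) + 2 * rho * M) * e1 * S <= e * S.
  rewrite ler_wpM2r //; apply: (@le_trans _ _ (2 * Q * e1)).
    by rewrite ler_wpM2r ?(ltW e10) //; rewrite /Q; move: Q0; rewrite /Q; lra.
  by rewrite /e1 mulrC divfK // gt_eqF // mulr_gt0.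
have h0 : 0 <= rho * e1 * S by apply: mulr_ge0 => //; apply: mulr_ge0 => //; exact: ltW.
split.
- rewrite (_ : _ - _ = cauchy_kernel s * (f (path t s) - f q0 - D * d) +
      ((t - t0) * rho) *: ((uexp J s - uexp J s0) * d)); last first.
    have -> : cauchy_kernel s * (f (path t s) - f q0 - D * d) =
        cauchy_kernel s * f (path t s) - cauchy_kernel s * f q0 -
        ((t - t0) *: (rho *: (uexp J s * d)) +
         cauchy_kernel s * (t0 *: (radius_vec s - radius_vec s0) * d)).
      rewrite DE1 mulrBr mulrBr; congr (_ - _); rewrite mulrDl mulrDr; congr (_ + _).
      by rewrite quat_scaleAl quat_scaleAr mulrA cauchy_kernelE quat_scaleAl.
    rewrite /form_dtheta mulrDr -scalerA mulrBl !scalerBr.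
    move: (cauchy_kernel s * f (path t s)) (cauchy_kernel s * f q0) (_ * (_ * d)).
    move: (_ *: (_ *: (_ * d))) (_ *: (_ *: (_ * d))) => p1 p2 p3 p4 p5.
    by apply: quat_ext; rewrite !quatE; ring.
  apply: le_trans (qabs_triangle _ _) _.
  apply: (@le_trans _ _ (C * (e1 * (2 * rho * S)) + S * rho * (2 * `|s - s0| * M))).
    apply: lerD; first by rewrite qabsM ler_pM ?qabs_ge0 ?qabs_cauchy_kernel.
    rewrite qabsZ qabsM normrM (ger0_norm rhoge0).
    rewrite ler_pM ?mulr_ge0 ?qabs_ge0 // ?ler_wpM2r // ?uexp_lipschitz //.
  have : 0 <= rho * a^-1 * e1 * S.
    by rewrite mulr_ge0 // mulr_ge0 ?(ltW e10) // mulr_ge0 // ltW.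
  lra.
- rewrite (_ : _ - _ = - t^-1 *: (J * (f (path t s) - f q0 - D * d)) -
      rho *: (J * (uexp J s - uexp J s0 - (s - s0) *: (J * uexp J s0)) * d)); last first.
    have -> : J * (f (path t s) - f q0 - D * d) =
        J * f (path t s) - J * (f q0 + (t - t0) *: radius_vec s0 * d) -
        t *: (rho *: (J * (uexp J s - uexp J s0) * d)).
      rewrite DE2 radius_vecB; move: (uexp J s - uexp J s0) (f q0) => w w0.
      rewrite -mulrA -2!quat_scaleAr -!mulrBr; congr (_ * _); rewrite mulrDl.
      rewrite (quat_scaleAl t) (quat_scaleAl rho).
      by rewrite !opprD !addrA.
    rewrite /form_dt !mulrBr !mulrBl !scalerBr !quat_scaleAr.
    rewrite [J * (J * _)]mulrA sphereS_sqr // mulN1r.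
    rewrite !quat_scaleAl !mulNr !scalerN.
    rewrite !scalerA !mulNr mulrA mulVf ?gt_eqF // mul1r.
    rewrite [rho * _]mulrC.
    move: (J * f (path t s)) (J * (f q0 + _)) (J * uexp J s * d)
      (J * uexp J s0 * d) (uexp J s0 * d).
    by move=> p1 p2 p3 p4 p5; apply: quat_ext; rewrite !quatE; ring.
  apply: le_trans (qabs_triangleB _ _) _.
  have qJ1 : qabs J = 1.
    by have [J0 J1] := sphereS_coord SJ; rewrite /qabs J0 expr0n /= add0r J1 sqrtr1.
  apply: (@le_trans _ _ (a^-1 * (e1 * (2 * rho * S)) + rho * (2 * `|s - s0| ^+ 2 * M))).
    apply: lerD.
      rewrite qabsZ normrN qabsM qJ1 mul1r ger0_norm ?invr_ge0 ?(ltW t1) //.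
      rewrite ler_pM ?invr_ge0 ?qabs_ge0 ?(ltW t1) // lef_pV2 ?posrE //; lra.
    rewrite qabsZ !qabsM qJ1 mul1r (ger0_norm rhoge0).
    by rewrite ler_wpM2l // ler_wpM2r // uexp_taylor1.
  have : 0 <= rho * C * e1 * S.
    by rewrite mulr_ge0 // mulr_ge0 ?(ltW e10) // mulr_ge0.
  have : rho * M * `|s - s0| * `|s - s0| <= rho * M * `|s - s0| * S.
    by rewrite ler_wpM2l // ?mulr_ge0.
  rewrite expr2; lra.
Qed.

(** The loop integral is the same at t = 1 and at any small t = a, where f is close to its value at
    c + z, a constant that leaves the integral on the right. The integral of the kernel is evaluated
    later, in [quat_int_cauchy_kernel]. *)
Lemma cauchy_formula :
  quat_int 0 tau (fun s => cauchy_kernel s * f (c + rho *: uexp J s)) =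
  quat_int 0 tau cauchy_kernel * f (c + z).
Proof.
pose C := rho / (rho - qabs z).
have C0 : 0 <= C by rewrite divr_ge0 ?subr_ge0 ?(ltW rho0) ?(ltW zrho).
have cK := @cont_on_cauchy_kernel 0 tau.
have Jcz : complex_line J (c + z) by apply: lineD.
have [d hd] : exists d, line_derivative J f (c + z) d.
  by apply: holf => //; rewrite addrAC subrr add0r ltW.
rewrite (@eq_quat_int _ _ _ _ (form_dtheta 1)); last first.
  by move=> s _; rewrite /form_dtheta /path scale1r /radius_vec -addrA subrKC.
have bound (e : R) : 0 < e -> qabs (quat_int 0 tau (form_dtheta 1) -
    quat_int 0 tau cauchy_kernel * f (c + z)) <= 2 * (C * e * tau).
  move=> e0; have [del del0 hdel] := line_derivative_continuous hd e0.
  (* [radius_vec] has modulus at most 2 rho, so the loop at t = a stays within del / 2 of c + z. *)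
  pose a := Num.min 1 (del / (4 * rho)).
  have a0 : 0 < a by rewrite lt_min ltr01 divr_gt0 // mulr_gt0.
  have a1 : a <= 1 by rewrite ge_min lexx.
  have a01 : 0 <= a <= 1 by rewrite (ltW a0).
  have adel : a * (2 * rho) < del.
    have : a <= del / (4 * rho) by rewrite ge_min lexx orbT.
    by rewrite ler_pdivlMr ?mulr_gt0 //; have := mulr_gt0 a0 rho0; lra.
  have -> : quat_int 0 tau (form_dtheta 1) = quat_int 0 tau (form_dtheta a).
    apply/eqP; rewrite -subr_eq0; apply/eqP.
    (* The sides s = 0 and s = 2 pi carry the same integral, because [uexp J] takes the value 1 at
       both. *)
    transitivity (quat_int a 1 (form_dt ^~ tau) - quat_int a 1 (form_dt ^~ 0)).
      apply: (quat_goursat a1 tau0).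
      - move=> t /andP[ta t1]; apply: cont_dtheta.
        by rewrite (le_trans (ltW a0)) ?t1.
      - by move=> s _; exact: cont_dt.
      - by move=> t s ta1 st; apply: forms_closed.
    apply/eqP; rewrite subr_eq0; apply/eqP/eq_quat_int => t _.
    by rewrite /form_dt /path /radius_vec uexp0 uexp2pi.
  have cf := @cont_dtheta a 0 tau a01.
  have cKf : cont_on 0 tau (fun s => cauchy_kernel s * f (c + z)).
    by apply: cont_on_quatM; [exact: cK|exact: cont_on_cst].
  have -> : quat_int 0 tau (form_dtheta a) - quat_int 0 tau cauchy_kernel * f (c + z) =
      quat_int 0 tau (fun s => form_dtheta a s - cauchy_kernel s * f (c + z)).
    by rewrite (quat_intB cf cKf) (quat_intMr (f (c + z)) cK).
  have := le_quat_int tau0 (mulr_ge0 C0 (ltW e0)) (cont_onB cf cKf).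
  rewrite subr0; apply.
  move=> s _; rewrite /form_dtheta -mulrBr qabsM.
  apply: ler_pM; [exact: qabs_ge0|exact: qabs_ge0|exact: qabs_cauchy_kernel|].
  apply/ltW/hdel; first exact: path_line.
  rewrite /path addrAC subrr add0r qabsZ (ger0_norm (ltW a0)).
  by apply: le_lt_trans adel; rewrite ler_wpM2l ?(ltW a0) ?radius_vec_le.
apply/eqP; rewrite -subr_eq0; apply/eqP/qabs_eq0/eqP.
rewrite eq_le qabs_ge0 andbT; apply/ler_addgt0Pl => e e0; rewrite addr0.
have k0 : 0 < 2 * (C * tau) + 1.
  by have h : 0 <= C * tau by [rewrite mulr_ge0]; lra.
apply: le_trans (bound (e / (2 * (C * tau) + 1)) (divr_gt0 e0 k0)) _.
rewrite [leLHS](_ : _ = e * (2 * (C * tau) / (2 * (C * tau) + 1))); last by ring.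
by rewrite ger_pMr // ler_pdivrMr // mul1r lerDl.
Qed.

End Formula.

End Kernel.

End Cauchy.

Section Taylor.
Variable R : realType.
Implicit Types (p q I J z c d : quat R) (f : quat R -> quat R).

Lemma quat_exprZ (k : R) q n : (k *: q) ^+ n = k ^+ n *: q ^+ n.
Proof.
elim: n => [|n ih]; first by rewrite !expr0 scale1r.
by rewrite !exprS ih quat_scaleAl quat_scaleAr scalerA.
Qed.

Lemma cont_onX a b (h : R -> quat R) n : cont_on a b h ->
  cont_on a b (fun x => h x ^+ n).
Proof.
move=> ch; elim: n => [|n ih]; first by under eq_fun do rewrite expr0; exact: cont_on_cst.
by under eq_fun do rewrite exprS; exact: cont_on_quatM.
Qed.

Let tau : R := pi *+ 2.

(** As rho^-1 e^(- J s) is the inverse of rho e^(J s), this is 2 pi times the usual integral for the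
    n-th Taylor coefficient when [psi] is f on the circle. *)
Definition circle_coef J (rho : R) (psi : R -> quat R) n : quat R :=
  quat_int 0 tau (fun s => (rho^-1 *: uexp J (- s)) ^+ n * psi s).

(** With U = (rho e^(J s))^-1 the kernel K solves K = 1 + z U K. Iterating gives the partial sums
    with exact remainder (z U)^n K, and |z U| = |z| / rho < 1. A general [psi] covers both f on the
    circle and the constant 1. *)
Lemma cauchy_kernel_series J z (rho : R) (psi : R -> quat R) :
  sphereS J -> complex_line J z -> qabs z < rho -> cont_on 0 tau psi ->
  series (fun n => z ^+ n * circle_coef J rho psi n) @ \oo -->
  quat_int 0 tau (fun s => cauchy_kernel J z rho s * psi s).
Proof.
move=> SJ Jz zrho cpsi.
have tau0 : 0 <= tau by rewrite mulrn_wge0 ?pi_ge0.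
have rho0 : 0 < rho by apply: le_lt_trans zrho; exact: qabs_ge0.
pose K := cauchy_kernel J z rho.
pose U (s : R) : quat R := rho^-1 *: uexp J (- s).
have cU : cont_on 0 tau U.
  by apply: cont_on_scale; [exact: cont_on_cst|exact: cont_on_uexpN].
have cK : cont_on 0 tau K by exact: cont_on_cauchy_kernel.
have JU s : complex_line J (U s) by apply/lineZ/uexp_line.
have JK s : complex_line J (K s) by exact: cauchy_kernel_line.
have KE s : K s = 1 + z * U s * K s.
  have uU : (rho *: uexp J s) * U s = 1.
    by rewrite /U quat_scaleAl quat_scaleAr scalerA divff ?gt_eqF // scale1r uexpN.
  have e1 : K s * (rho *: uexp J s) - K s * z = rho *: uexp J s.
    by rewrite -mulrBr; exact: cauchy_kernelE.
  have := congr1 (fun p => p * U s) e1.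
  rewrite /= uU mulrBl -[K s * _ * U s]mulrA uU mulr1 -[K s * z * U s]mulrA.
  rewrite (line_comm SJ (JK s) (lineM SJ Jz (JU s))).
  by move=> <-; rewrite subrK.
have cZ n : cont_on 0 tau (fun s => (z * U s) ^+ n).
  by apply/cont_onX/cont_on_quatM => //; exact: cont_on_cst.
have cUpsi m : cont_on 0 tau (fun s => U s ^+ m * psi s).
  by apply: cont_on_quatM; [exact: cont_onX|exact: cpsi].
have cZK m : cont_on 0 tau (fun s => (z * U s) ^+ m * K s * psi s).
  apply: cont_on_quatM; last exact: cpsi.
  by apply: cont_on_quatM; [exact: cZ|exact: cK].
have step n : quat_int 0 tau (fun s => (z * U s) ^+ n * K s * psi s) =
    z ^+ n * circle_coef J rho psi n +
    quat_int 0 tau (fun s => (z * U s) ^+ n.+1 * K s * psi s).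
  rewrite /circle_coef -quat_intMl; last exact: cUpsi.
  rewrite -quat_intD; first last.
  - exact: cZK.
  - by apply: cont_on_quatM; [exact: cont_on_cst|exact: cUpsi].
  apply: eq_quat_int => s _; rewrite {1}KE mulrDr mulr1 mulrDl !mulrA exprSr !mulrA.
  congr (_ * _ + _); rewrite exprMn_comm //.
  exact: line_comm SJ Jz (JU s).
have rem n : quat_int 0 tau (fun s => K s * psi s) -
    series (fun n => z ^+ n * circle_coef J rho psi n) n =
    quat_int 0 tau (fun s => (z * U s) ^+ n * K s * psi s).
  elim: n => [|n ih].
    rewrite /series /= big_geq // subr0.
    by apply: eq_quat_int => s _; rewrite expr0 mul1r.
  by rewrite /series /= big_nat_recr //= opprD addrA ih step addrC addKr.
have [P P0 psiP] := cont_on_bounded tau0 cpsi.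
pose C := rho / (rho - qabs z).
have C0 : 0 <= C by rewrite divr_ge0 ?subr_ge0 ?(ltW rho0) ?(ltW zrho).
pose r := qabs z / rho.
have r0 : 0 <= r by rewrite divr_ge0 ?qabs_ge0 ?(ltW rho0).
have r1 : `|r| < 1 by rewrite ger0_norm // ltr_pdivrMr ?mul1r.
have k0 : 0 < 2 * (C * P * tau) + 1.
  have h : 0 <= C * P * tau by rewrite mulr_ge0 // mulr_ge0.
  lra.
apply/cvg_qabsP => e e0.
have /cvgrPdist_lt /(_ _ (divr_gt0 e0 k0)) := cvg_expr r1.
apply: filterS => n; rewrite sub0r normrN normrX (ger0_norm r0) => hn.
rewrite qabs_distC rem.
apply: (@le_lt_trans _ _ (2 * (r ^+ n * C * P * tau))).
  have k1 : 0 <= r ^+ n * C * P by rewrite mulr_ge0 // mulr_ge0 // exprn_ge0.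
  have := le_quat_int tau0 k1 (cZK n).
  rewrite subr0; apply.
  move=> s stau; rewrite !qabsM qabsX qabsM.
  apply: ler_pM; rewrite ?psiP ?qabs_ge0 //.
    by rewrite mulr_ge0 ?qabs_ge0 ?exprn_ge0 ?mulr_ge0 ?qabs_ge0.
  apply: ler_pM; rewrite ?qabs_ge0 ?qabs_cauchy_kernel ?exprn_ge0 ?mulr_ge0 ?qabs_ge0 //.
  have zU0 : 0 <= qabs z * qabs (U s) by rewrite mulr_ge0 ?qabs_ge0.
  rewrite lerXn2r ?nnegrE //.
  by rewrite /U qabsZ qabs_uexp // mulr1 ger0_norm ?invr_ge0 ?(ltW rho0).
move: hn; rewrite ltr_pdivlMr //; apply: le_lt_trans.
have : 0 <= r ^+ n by rewrite exprn_ge0.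
by lra.
Qed.

Lemma circle_coef1 J (rho : R) n : sphereS J ->
  circle_coef J rho (fun=> 1) n = (n == 0%N)%:R * tau *: (1 : quat R).
Proof.
move=> SJ; rewrite /circle_coef.
under eq_quat_int do rewrite mulr1 quat_exprZ -[_ ^+ n *: _]mul1r quat_scaleAr
  -quat_scaleAl.
rewrite quat_intMl; last by apply/cont_onX/cont_on_uexpN.
rewrite quat_int_uexpNX //; case: eqP => [->|_]; last by rewrite mul0r scale0r mulr0.
by rewrite expr0 scale1r mul1r.
Qed.

(** The series for the constant 1: only the coefficient of index 0 survives, and the partial sums
    are constant from rank 1 on, the one of rank 0 being empty. *)
Lemma quat_int_cauchy_kernel J z (rho : R) :
  sphereS J -> complex_line J z -> qabs z < rho ->
  quat_int 0 tau (cauchy_kernel J z rho) = tau *: (1 : quat R).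
Proof.
move=> SJ Jz zrho.
have := cauchy_kernel_series SJ Jz zrho (@cont_on_cst R _ 0 tau (1 : quat R)).
under [X in _ --> X]eq_quat_int do rewrite mulr1.
move=> h; apply: (cvg_unique (@norm_hausdorff _ _) h).
apply: cvg_near_cst; exists 1%N => // n /= n0.
rewrite /series /= big_ltn // circle_coef1 // expr0 !mul1r big_nat_cond big1 ?addr0 //.
by move=> k /andP[/andP[k0 _] _]; rewrite circle_coef1 // gtn_eqF // mul0r scale0r mulr0.
Qed.

(** The closed disc appears in the hypothesis because the coefficients are integrals over its
    boundary circle; the expansion holds in the open disc. *)
Lemma taylor_disc J f c (rho : R) : sphereS J -> complex_line J c -> 0 < rho ->
  (forall q, complex_line J q -> qabs (q - c) <= rho ->
     exists d, line_derivative J f q d) ->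
  exists b : nat -> quat R, forall q, complex_line J q -> qabs (q - c) < rho ->
    series (fun n => (q - c) ^+ n * b n) @ \oo --> f q.
Proof.
move=> SJ Jc rho0 holf.
pose psi (s : R) : quat R := f (c + rho *: uexp J s).
have tau_gt0 : 0 < tau by rewrite pmulrn_lgt0 ?pi_gt0.
have cpsi : cont_on 0 tau psi.
  apply: (@cont_on_comp_line _ J f) => [|s|s _].
  - apply: cont_onD; first exact: cont_on_cst.
    by apply: cont_on_scale; [exact: cont_on_cst|exact: cont_on_uexp].
  - by apply: lineD => //; apply/lineZ/uexp_line.
  - apply: holf; first by apply: lineD => //; apply/lineZ/uexp_line.
    by rewrite addrAC subrr add0r qabsZ qabs_uexp // mulr1 ger0_norm ?(ltW rho0).
exists (fun n => tau^-1 *: circle_coef J rho psi n) => q Jq qrho.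
have Jz : complex_line J (q - c) by exact: lineB.
have := cauchy_kernel_series SJ Jz qrho cpsi.
rewrite (cauchy_formula SJ Jz qrho Jc holf) subrKC.
rewrite (quat_int_cauchy_kernel SJ Jz qrho) quat_scaleAl mul1r => h.
have -> : f q = tau^-1 *: (tau *: f q) by rewrite scalerA mulVf ?gt_eqF // scale1r.
rewrite (_ : series _ = fun n => tau^-1 *:
    series (fun n => (q - c) ^+ n * circle_coef J rho psi n) n); first exact: cvgZr.
apply/funext => n; rewrite /series /= scaler_sumr.
by apply: eq_bigr => k _; rewrite quat_scaleAr.
Qed.

End Taylor.

(** * Segments and the sigma-boundary *)

Section SigmaGeometry.
Variable R : realType.
Implicit Types (p q u v I J : quat R) (Omega : set (quat R)) (f : quat R -> quat R).

Lemma nbhs_qabsP q (A : set (quat R)) :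
  nbhs q A <-> exists2 e : R, 0 < e & forall p, qabs (p - q) < e -> A p.
Proof.
split=> [/nbhs_ballP[e /= e0 eA]|[e e0 eA]].
  exists e => // p pe; apply: eA; rewrite -ball_normE /ball_ /= distrC.
  by apply: le_lt_trans pe; exact: norm_le_qabs.
apply/nbhs_ballP; exists (e / 2) => /=; first by rewrite divr_gt0.
move=> p; rewrite -ball_normE /ball_ /= distrC => pe; apply: eA.
by have := qabs_le_norm (p - q); lra.
Qed.

Lemma nbhs_sigmaP q (A : set (quat R)) :
  nbhs (q : squat R) (A : set (squat R)) <->
  exists2 e : R, 0 < e & forall p, sigma q p < e -> A p.
Proof.
by split=> [/nbhs_ballP[e /= e0 eA]|[e e0 eA]]; [exists e|apply/nbhs_ballP; exists e].
Qed.

(** [sigma] dominates the modulus, so a Euclidean open set is open for [sigma] and misses its own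
    boundary. *)
Lemma open_sigma_boundary Omega q : open Omega -> Omega q ->
  ~ sigma_boundary Omega q.
Proof.
move=> oO Oq [_]; apply; apply/nbhs_sigmaP.
have /nbhs_qabsP[e e0 he] := open_nbhs_nbhs (conj oO Oq).
exists e => // p pe; apply: he; apply: le_lt_trans pe.
by rewrite qabs_distC; exact: qabs_le_sigma.
Qed.

Lemma sigma_line J p q : sphereS J -> complex_line J p -> complex_line J q ->
  sigma p q = qabs (p - q).
Proof. by move=> SJ Jp Jq; rewrite /sigma asboolT //; exists J. Qed.

(** The parameters sent into [Omega] form an open and closed part of [0, 1]. Closedness holds
    because [sigma] is the modulus along a line: a limit parameter outside [Omega] would give a
    point of the sigma-boundary, not just of the Euclidean one. *)
Lemma segment_in_domain J Omega u v : open Omega -> sphereS J ->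
  complex_line J u -> complex_line J v -> Omega u ->
  (forall t : R, 0 <= t <= 1 -> ~ sigma_boundary Omega (u + t *: (v - u))) ->
  Omega v.
Proof.
move=> oO SJ Ju Jv Ou nb.
pose g (t : R) := u + t *: (v - u).
have Jg t : complex_line J (g t) by apply: lineD => //; apply/lineZ/lineB.
have gB s t : qabs (g s - g t) = `|s - t| * qabs (v - u).
  by rewrite /g opprD addrACA subrr add0r -scalerBl qabsZ.
have k0 : 0 < qabs (v - u) + 1 by have := qabs_ge0 (v - u); lra.
have gnear t (e : R) : 0 < e -> \forall s \near t, qabs (g s - g t) < e.
  move=> e0; have d0 : 0 < e / (qabs (v - u) + 1) by rewrite divr_gt0.
  apply: filterS (nbhsx_ballx t _ d0) => s; rewrite -ball_normE /ball_ /= distrC.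
  rewrite ltr_pdivlMr // gB; apply: le_lt_trans.
  by rewrite ler_wpM2l // lerDl.
pose B := `[0, 1]%classic `&` (g @^-1` Omega) : set R.
have conn : connected (`[0, 1]%classic : set R).
  by apply/connected_intervalP; exact: interval_is_interval.
have : B = `[0, 1]%classic.
  apply: conn.
  - by exists 0; split; [rewrite /= in_itv /= lexx ler01|rewrite /= /g scale0r addr0].
  - exists (g @^-1` Omega) => // ; rewrite openE => t Ogt.
    have /nbhs_qabsP[e e0 he] := open_nbhs_nbhs (conj oO Ogt).
    by apply: filterS (gnear t e e0) => s; exact: he.
  - exists (closure (g @^-1` Omega)); first exact: closed_closure.
    apply/seteqP; split=> [t [t01 Ot]|t [t01 ct]]; split => //.
      exact: subset_closure.
    have t01' : 0 <= t <= 1 by move: t01; rewrite /= in_itv.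
    apply: contrapT => nOt; apply: (nb t t01'); split.
      move=> A /nbhs_sigmaP[e e0 he].
      have [s [Os /= sA]] := ct _ (gnear t e e0).
      exists (g s); split => //; apply: he.
      by rewrite (sigma_line SJ (Jg t) (Jg s)) qabs_distC.
    by move=> /nbhs_sigmaP[e e0 he]; apply: nOt; apply: he; rewrite sigmaxx.
move=> BE; have : B 1 by rewrite BE /= in_itv /= ler01 lexx.
by case=> _; rewrite /= /g scale1r subrKC.
Qed.

Lemma slice_regular_line_derivative Omega f J q : slice_regular Omega f ->
  sphereS J -> complex_line J q -> Omega q -> exists d, line_derivative J f q d.
Proof.
move=> fO SJ [w _ <-] Ow; have [df CR] := fO J SJ w Ow.
pose g := f \o slice_pt J.
have d1 := deriveE ((1, 0) : R * R) df; have d2 := deriveE ((0, 1) : R * R) df.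
rewrite d1 d2 in CR; pose d := 'd (f \o slice_pt J) w ((1, 0) : R * R); rewrite -/d in CR.
exists d => e e0.
have dE (h : R * R) : 'd g w h = slice_pt J h * d.
  have hE : h = h.1 *: ((1, 0) : R * R) + h.2 *: ((0, 1) : R * R).
    case: h => x y; congr pair => /=; rewrite /GRing.scale /=; lra.
  rewrite [in LHS]hE linearD !linearZ.
  (* The Cauchy-Riemann equation, doubled and multiplied by J on the left, expresses the
     y-derivative by the x-derivative. *)
  have : 'd g w ((0, 1) : R * R) = J * d.
    move: CR => /(congr1 (fun p => J * (2 *: p))).
    rewrite scalerA divff // scale1r scaler0 mulr0 mulrDr mulrA sphereS_sqr //.
    by rewrite mulN1r => /eqP; rewrite subr_eq0 => /eqP.
  by move=> ->; rewrite -/d /slice_pt mulrDl !quat_scaleAl mul1r.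
(* Half of e, because passing from the sup norm to the modulus of the values costs a factor 2. *)
have e4 : 0 < e / 2 by lra.
have /eqaddoP/(_ _ e4) := diff_locally df.
move=> /nbhs_ballP[del /= del0 hdel].
exists del => // _ [v _ <-]; rewrite -slice_ptN -slice_ptD => vdel.
have hle : `|v - w| <= qabs (slice_pt J (v - w)).
  rewrite qabs_slice // [`|v - w|]/Num.norm /= ge_max -!sqrtr_sqr.
  by apply/andP; split; apply: ler_wsqrtr; rewrite ?lerDl ?lerDr sqr_ge0.
have := hdel (v - w); rewrite -ball_normE /ball_ /= sub0r normrN => h.
have {h} := h (le_lt_trans hle vdel).
rewrite !fctE /= subrK dE opprD addrA => h.
apply: le_trans (qabs_le_norm _) _.
have := ler_wpM2l (ltW e0) hle.
by move: h; lra.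
Qed.

End SigmaGeometry.

(** * Power series and regular powers *)

Section PowerSeries.
Variables (R : realType) (V : normedModType R).

(** From 2 x <= 1 one gets x^k <= 2 x^k - 2 x^(k+1), and the right-hand sides telescope. *)
Lemma sum_geometric_half (x : R) m N : 0 <= x -> 2 * x <= 1 -> (m <= N)%N ->
  \sum_(m <= k < N) x ^+ k <= 2 * x ^+ m - 2 * x ^+ N.
Proof.
move=> x0 x1; elim: N => [|N ih].
  by rewrite leqn0 => /eqP ->; rewrite big_geq // subrr.
rewrite leq_eqVlt => /predU1P[->|]; first by rewrite big_geq // subrr.
rewrite ltnS => mN; rewrite big_nat_recr //= exprS.
by have := ler_wpM2r (exprn_ge0 N x0) x1; have := ih mN; lra.
Qed.

(** Once the coefficients below n vanish, dividing the series by s^n leaves d_n plus a tail of order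
    s, and s tends to 0. Real parameters suffice, so lines that meet only in the real axis can be
    compared. *)
Lemma power_series_eq0 (d : nat -> V) (rho : R) : 0 < rho ->
  (forall s : R, `|s| < rho -> series (fun n => s ^+ n *: d n) @ \oo --> (0 : V)) ->
  forall n, d n = 0.
Proof.
move=> rho0 hd n; elim/ltn_ind: n => n ih.
pose s0 := rho / 2; have s00 : 0 < s0 by rewrite divr_gt0.
have s0rho : `|s0| < rho by rewrite ger0_norm ?(ltW s00) // /s0; lra.
have [P P0 hP] : exists2 P : R, 0 <= P & forall k, `|d k| <= P / s0 ^+ k.
  have cv : cvgn (series (fun n => s0 ^+ n *: d n)).
    by apply/cvg_ex; exists (0 : V); exact: hd.
  have cv0 : cvgn (fun n => s0 ^+ n *: d n).
    by apply/cvg_ex; exists (0 : V); exact: cvg_series_cvg_0 cv.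
  have [M [_ hM]] := cvg_seq_bounded cv0; exists (`|M| + 1); first by rewrite addr_ge0.
  move=> k; rewrite ler_pdivlMr ?exprn_gt0 // mulrC.
  have := hM (`|M| + 1); rewrite (le_lt_trans (ler_norm _)) ?ltrDl // => /(_ isT k).
  by rewrite /= normrZ normrX (ger0_norm (ltW s00)); apply.
(* The condition 2 s <= s0 makes s / s0 at most 1/2, so that the tail is bounded by twice its first
   term. *)
have bound (s : R) : 0 < s -> 2 * s <= s0 ->
    `|d n| <= 2 * P / s0 ^+ n.+1 * s.
  move=> sp ss0.
  have srho : `|s| < rho by rewrite ger0_norm ?(ltW sp) //; move: ss0; rewrite /s0; lra.
  have sn0 : 0 < s ^+ n by rewrite exprn_gt0.
  rewrite -(ler_pM2l sn0).
  apply/ler_addgt0Pl => e e0.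
  have /cvgrPdist_lt /(_ _ e0) [N _ hN] := hd s srho.
  (* The partial sum has to be close to its limit and also to contain the term of index n. *)
  have := hN (maxn N n.+1) (leq_maxl _ _); rewrite /= sub0r normrN.
  have nm : (n.+1 <= maxn N n.+1)%N by exact: leq_maxr.
  move: (maxn N n.+1) nm => m nm.
  rewrite /series /= (big_cat_nat (n := n.+1)) //= big_nat_recr //=.
  rewrite big_nat_cond big1 ?add0r => [hm|k /andP[/andP[_ kn] _]]; last first.
    by rewrite ih // scaler0.
  have tail : `|\sum_(n.+1 <= k < m) s ^+ k *: d k| <= P * (2 * (s / s0) ^+ n.+1).
    apply: le_trans (ler_norm_sum _ _ _) _.
    apply: (@le_trans _ _ (\sum_(n.+1 <= k < m) P * (s / s0) ^+ k)).
      apply: ler_sum => k _; rewrite normrZ normrX (ger0_norm (ltW sp)) exprMn.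
      rewrite mulrCA exprVn; apply: ler_wpM2l; first by rewrite exprn_ge0 ?(ltW sp).
      exact: hP.
    rewrite -mulr_sumr ler_wpM2l //.
    have x0 : 0 <= s / s0 by rewrite divr_ge0 ?(ltW sp) ?(ltW s00).
    apply: le_trans (sum_geometric_half x0 _ nm) _.
      by rewrite mulrA ler_pdivrMr // mul1r.
    by rewrite gerBl mulr_ge0 // exprn_ge0.
  have : `|s ^+ n *: d n| <= e + P * (2 * (s / s0) ^+ n.+1).
    rewrite -[s ^+ n *: d n](addrK (\sum_(n.+1 <= k < m) s ^+ k *: d k)).
    by apply: le_trans (ler_normB _ _) _; apply: lerD; first exact: ltW.
  rewrite normrZ normrX (ger0_norm (ltW sp)) => /le_trans; apply.
  rewrite lerD2l expr_div_n exprS [leRHS](_ : _ = P * (2 * (s * s ^+ n / s0 ^+ n.+1))) //.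
  by ring.
apply/eqP; rewrite -normr_le0; apply/ler_addgt0Pl => e e0; rewrite addr0.
set k := 2 * P / s0 ^+ n.+1 in bound.
have k0 : 0 <= k by rewrite divr_ge0 ?mulr_ge0 // exprn_ge0 ?(ltW s00).
have k1 : 0 < k + 1 by lra.
pose s := Num.min (s0 / 2) (e / (k + 1)).
have sp : 0 < s by rewrite lt_min !divr_gt0.
have ss0 : 2 * s <= s0.
  have : s <= s0 / 2 by rewrite ge_min lexx.
  lra.
have : s <= e / (k + 1) by rewrite ge_min lexx orbT.
rewrite ler_pdivlMr // => se; apply: le_trans (bound s sp ss0) _.
by move: se; rewrite mulrDr mulr1 mulrC; lra.
Qed.

End PowerSeries.

Section RegularPowers.
Variable R : realType.
Implicit Types (p q I J : quat R) (P : {poly quat R}) (x y : R).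

Lemma horner_right_widen P q N : (size P <= N)%N ->
  horner_right P q = \sum_(k < N) q ^+ k * P`_k.
Proof.
move=> PN; rewrite /horner_right (big_ord_widen _ (fun k : nat => q ^+ k * P`_k) PN).
rewrite big_mkcond /=; apply: eq_bigr => k _.
by case: ltnP => // sk; rewrite nth_default // mulr0.
Qed.

(** Evaluation with coefficients on the right is not multiplicative: the indeterminate passes
    through the coefficients and becomes a q on the left, while p stays on the right. *)
Lemma horner_right_mulXsubC P p q :
  horner_right (P * ('X - p%:P)) q = q * horner_right P q - horner_right P q * p.
Proof.
have sz : (size (P * ('X - p%:P))%R <= (size P).+1)%N.
  by apply: leq_trans (size_polyMleq _ _) _; rewrite size_XsubC addn2.
rewrite (horner_right_widen q sz) {1}/horner_right.
rewrite (horner_right_widen q (leqnSn (size P))).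
rewrite mulr_sumr mulr_suml.
under eq_bigr do rewrite mulrBr coefB coefMX coefMC mulrBr mulrA.
rewrite sumrB; congr (_ - _); rewrite big_ord_recl /= mulr0 add0r.
by apply: eq_bigr => k _; rewrite exprS mulrA.
Qed.

Lemma regular_powS p n q :
  regular_pow p n.+1 q = q * regular_pow p n q - regular_pow p n q * p.
Proof. by rewrite /regular_pow exprSr horner_right_mulXsubC. Qed.

Lemma regular_pow0 p q : regular_pow p 0 q = 1.
Proof.
by rewrite /regular_pow expr0 /horner_right size_poly1 big_ord1 coef1 expr0 mulr1.
Qed.

(* The coefficients of the representation formula
   f(x + J y) = lproj f(x + I y) + rproj f(x - I y). *)
Definition lproj J I : quat R := 2^-1 *: (1 - J * I).
Definition rproj J I : quat R := 2^-1 *: (1 + J * I).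

Lemma lproj_rproj J I : lproj J I + rproj J I = 1.
Proof.
rewrite /lproj /rproj; move: (J * I) => K; apply: quat_ext; rewrite !quatE; lra.
Qed.

(** Reduces to J (1 - J I) = J + I = (1 - J I) I. Likewise J (1 + J I) = J - I = (1 + J I) (- I) for
    [rproj], whence the conjugate point there. *)
Lemma lprojP J I x y : sphereS J -> sphereS I ->
  slice_pt J (x, y) * lproj J I = lproj J I * slice_pt I (x, y).
Proof.
move=> SJ SI; rewrite /lproj quat_scaleAr quat_scaleAl; congr (_ *: _).
rewrite /slice_pt /= mulrBr mulrBl mulr1 mul1r !mulrDl !mulrDr.
rewrite !quat_scaleAl !quat_scaleAr !mul1r !mulr1 mulrA sphereS_sqr //.
rewrite -[J * I * I]mulrA sphereS_sqr // mulrN1 mulN1r !scalerN.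
by move: (J * I) => K; apply: quat_ext; rewrite !quatE; ring.
Qed.

Lemma rprojP J I x y : sphereS J -> sphereS I ->
  slice_pt J (x, y) * rproj J I = rproj J I * slice_pt I (x, - y).
Proof.
move=> SJ SI; rewrite /rproj quat_scaleAr quat_scaleAl; congr (_ *: _).
rewrite /slice_pt /= mulrDr [RHS]mulrDl mulr1 mul1r !mulrDl !mulrDr.
rewrite !quat_scaleAl !quat_scaleAr !mul1r !mulr1 mulrA sphereS_sqr //.
rewrite -[J * I * I]mulrA sphereS_sqr // mulrN1 mulN1r !scalerN.
by move: (J * I) => K; apply: quat_ext; rewrite !quatE; ring.
Qed.

(** Both sides obey the recursion g -> q g - g p: [lprojP] and [rprojP] carry q through the
    projections to points of L_I, and these commute with p. *)
Lemma regular_pow_split I J p x y n : sphereS I -> sphereS J -> complex_line I p ->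
  regular_pow p n (slice_pt J (x, y)) =
  lproj J I * (slice_pt I (x, y) - p) ^+ n + rproj J I * (slice_pt I (x, - y) - p) ^+ n.
Proof.
move=> SI SJ Ip.
have ql := lprojP x y SJ SI; have qr := rprojP x y SJ SI.
have comm w k : complex_line I w -> (w - p) ^+ k * p = p * (w - p) ^+ k.
  by move=> Iw; apply: (line_comm SI) => //; apply: lineX => //; exact: lineB.
have cz k := comm _ k (line_pt I (x, y)); have cz' k := comm _ k (line_pt I (x, - y)).
move: (slice_pt J (x, y)) (slice_pt I (x, y)) (slice_pt I (x, - y)) ql qr cz cz'.
move: (lproj J I) (rproj J I) (lproj_rproj J I) => a b ab q z z' ql qr cz cz'.
elim: n => [|n ih]; first by rewrite regular_pow0 !expr0 !mulr1 ab.
rewrite regular_powS ih !exprS mulrDr mulrDl !mulrA ql qr -!mulrA cz cz'.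
by rewrite opprD addrACA !mulrBl !mulrBr.
Qed.

End RegularPowers.

(** * Analyticity of slice regular functions *)

Local Notation "k %:H" := (k *: (1 : quat _))
  (at level 1, left associativity, format "k %:H") : ring_scope.

Section Analyticity.
Variable R : realType.
Implicit Types (p q I J : quat R) (Omega : set (quat R)) (f : quat R -> quat R) (x y : R).

Lemma eq_cvg_seq (T : topologicalType) (u v : nat -> T) (l : T) :
  u =1 v -> u @ \oo --> l -> v @ \oo --> l.
Proof. by move=> /funext ->. Qed.

Lemma cvg_series_quat_comb p q (u v : nat -> quat R) (l m : quat R) :
  series u @ \oo --> l -> series v @ \oo --> m ->
  series (fun n => p * u n + q * v n) @ \oo --> p * l + q * m.
Proof.
move=> ul vm.
have pu : (fun n => p * series u n) @ \oo --> p * l.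
  by apply: cvg_quatM => //; exact: cvg_cst.
have qv : (fun n => q * series v n) @ \oo --> q * m.
  by apply: cvg_quatM => //; exact: cvg_cst.
apply: eq_cvg_seq (cvgD pu qv) => n.
by rewrite !fctE /series /= !mulr_sumr -big_split.
Qed.

(* Both expansions converge to the same function on the real axis. *)
Lemma real_center_expansion f (a rho : R) : 0 < rho ->
  (forall J, sphereS J -> forall q, complex_line J q -> qabs (q - a%:H) <= rho ->
     exists d, line_derivative J f q d) ->
  exists c : nat -> quat R, forall q, qabs (q - a%:H) < rho ->
    series (fun n => (q - a%:H) ^+ n * c n) @ \oo --> f q.
Proof.
move=> rho0 holf.
have taylor J : sphereS J -> exists c : nat -> quat R,
    forall q, complex_line J q -> qabs (q - a%:H) < rho ->
    series (fun n => (q - a%:H) ^+ n * c n) @ \oo --> f q.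
  by move=> SJ; apply: taylor_disc SJ (line_real J a) rho0 (holf J SJ).
(* Only serves to produce some imaginary unit. *)
have [I [SI _ _]] := common_line_refl (0 : quat R).
have [c hc] := taylor I SI; exists c => q qrho.
have [J [SJ Jq _]] := common_line_refl q.
have [c' hc'] := taylor J SJ.
suff -> : c = c' by exact: hc'.
apply/funext => n; apply/eqP; rewrite -subr_eq0; apply/eqP; move: n.
apply: (@power_series_eq0 R (quat R) (fun n => c n - c' n) rho rho0) => s srho.
pose u := (a + s)%:H.
have us : u - a%:H = s%:H by rewrite /u scalerDl addrAC subrr add0r.
have urho : qabs (u - a%:H) < rho by rewrite us qabsZ qabs1 mulr1.
have h := hc u (line_real I _) urho; have h' := hc' u (line_real J _) urho.
have := cvgB h h'; rewrite subrr us => hB; apply: eq_cvg_seq (hB _) => n.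
rewrite !fctE /series /= -sumrB; apply: eq_bigr => k _.
by rewrite -mulrBr quat_exprZ expr1n quat_scaleAl mul1r.
Qed.

(** The points x + J y and x + I y, x - I y are equally far from a, so one expansion at a covers all
    three, and [regular_pow_split] applies to it term by term. *)
Lemma slice_representation f (a rho : R) I J x y : 0 < rho ->
  sphereS I -> sphereS J ->
  (forall J, sphereS J -> forall q, complex_line J q -> qabs (q - a%:H) <= rho ->
     exists d, line_derivative J f q d) ->
  qabs (slice_pt J (x, y) - a%:H) < rho ->
  f (slice_pt J (x, y)) =
  lproj J I * f (slice_pt I (x, y)) + rproj J I * f (slice_pt I (x, - y)).
Proof.
move=> rho0 SI SJ holf qrho.
have [c hc] := real_center_expansion rho0 holf.
have aE K : a%:H = slice_pt K (a, 0) by rewrite /slice_pt /= scale0r addr0.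
have nE K (t : R) : sphereS K ->
    qabs (slice_pt K (x, t) - a%:H) = Num.sqrt ((x - a) ^+ 2 + t ^+ 2).
  by move=> SK; rewrite (aE K) -slice_ptN -slice_ptD qabs_slice //= oppr0 addr0.
rewrite nE // in qrho.
have hq := hc (slice_pt J (x, y)); rewrite nE // in hq.
have hz := hc (slice_pt I (x, y)); rewrite nE // in hz.
have hz' := hc (slice_pt I (x, - y)); rewrite nE // sqrrN in hz'.
have := @cvg_series_quat_comb (lproj J I) (rproj J I) _ _ _ _ (hz qrho) (hz' qrho).
apply: (cvg_unique (@norm_hausdorff _ _)); 
apply: eq_cvg_seq (hq qrho) => n.
apply: eq_bigr => k _.
rewrite !mulrA -mulrDl; congr (_ * _).
rewrite -(regular_pow_split x y k SI SJ (line_real I a)).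
(* As a is real it is central, and the regular powers of q - a are its ordinary powers. *)
elim: k => [|k ih]; first by rewrite regular_pow0.
rewrite regular_powS -ih exprS mulrBl; congr (_ - _).
by rewrite quat_scaleAl quat_scaleAr mul1r mulr1.
Qed.

Lemma qIm_real_part q : q - (qRe q)%:H = qIm q.
Proof. by apply: quat_ext; rewrite /qIm !quatE; ring. Qed.

Lemma qabs_qIm_le q : qabs (qIm q) <= qabs q.
Proof.
apply: ler_wsqrtr; rewrite /qIm !quatE expr0n /=.
by have := sqr_ge0 (qRe q); lra.
Qed.

Lemma qabs_qImB p q : qabs (qIm p) <= qabs (p - q) + qabs (qIm q).
Proof.
rewrite -[qIm p](subrK (qIm q)) -qImB; apply: le_trans (qabs_triangle _ _) _.
by rewrite lerD2r qabs_qIm_le.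
Qed.

(** The strict inequality leaves room for a real [rho] below the distance, also when the boundary is
    empty and the distance infinite; even the closed sigma-ball of radius [rho] then misses the
    boundary. *)
Lemma analytic_locus_radius Omega p : analytic_locus Omega p ->
  exists2 rho : R, 2 * qabs (qIm p) < rho &
    forall q, sigma p q <= rho -> ~ sigma_boundary Omega q.
Proof.
case=> _; rewrite /sigma_dist; set S := [set _ | _ in _] => h.
have [rho [r1 r2]] : exists rho : R, 2 * qabs (qIm p) < rho /\ (rho%:E < ereal_inf S)%E.
  case: (ereal_inf S) h => [r| |] //.
    rewrite lte_fin => h; exists ((2 * qabs (qIm p) + r) / 2); rewrite lte_fin.
    by split; lra.
  by move=> _; exists (2 * qabs (qIm p) + 1); rewrite ltry; split => //; lra.
exists rho => // q qr dq.
have : (ereal_inf S <= (sigma p q)%:E)%E by apply: ereal_inf_lbound; exists q.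
by move=> /(lt_le_trans r2); rewrite lte_fin ltNge qr.
Qed.

Lemma slice_regular_analytic Omega f p : open Omega -> slice_regular Omega f ->
  analytic_locus Omega p -> quaternionic_analytic Omega f p.
Proof.
move=> oO fO Ap; have Op : Omega p by case: Ap.
have [rho bb nb] := analytic_locus_radius Ap.
pose b := qabs (qIm p); pose a := qRe p.
have b0 : 0 <= b by exact: qabs_ge0.
have pa : qabs (p - a%:H) = b by rewrite qIm_real_part.
have [I [SI Ip _]] := common_line_refl p.
have rho0 : 0 < rho by apply: le_lt_trans bb; rewrite mulr_ge0.
have rhob : 0 < rho - b by move: bb; rewrite -/b; lra.
have OI q : complex_line I q -> qabs (q - p) <= rho -> Omega q.
  move=> Iq qp; apply: (segment_in_domain oO SI Ip Iq Op) => t t01; apply: nb.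
  rewrite (sigma_line SI Ip); last by apply: lineD => //; apply/lineZ/lineB.
  rewrite opprD addrA subrr add0r qabsN qabsZ ger0_norm ?(andP t01).1 //.
  by apply: le_trans qp; rewrite ler_piMl ?qabs_ge0 ?(andP t01).2.
have Oa : Omega (a%:H).
  by apply: OI; [exact: line_real|rewrite qabs_distC pa; move: bb; rewrite -/b; lra].
(* The segment starts at a rather than at p, since p need not lie in L_J; the triangle inequality
   for [sigma] through a turns rho into rho - b. *)
have OJ J q : sphereS J -> complex_line J q -> qabs (q - a%:H) <= rho - b -> Omega q.
  move=> SJ Jq qa; apply: (segment_in_domain oO SJ (line_real J a) Jq Oa) => t t01.
  apply: nb; apply: le_trans (sigma_triangle (a%:H) _ _) _.
  rewrite (sigma_line SI Ip (line_real I a)) pa.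
  rewrite (sigma_line SJ (line_real J a)); last first.
    by apply: lineD; [exact: line_real|apply/lineZ/lineB => //; exact: line_real].
  rewrite opprD addrA subrr add0r qabsN qabsZ ger0_norm ?(andP t01).1 //.
  have : t * qabs (q - a%:H) <= qabs (q - a%:H).
    by rewrite ler_piMl ?qabs_ge0 ?(andP t01).2.
  by move: qa; lra.
have hola J : sphereS J -> forall q, complex_line J q ->
    qabs (q - a%:H) <= rho - b -> exists d, line_derivative J f q d.
  move=> SJ q Jq qa; apply: (slice_regular_line_derivative fO SJ Jq).
  exact: OJ SJ Jq qa.
have [c hc] : exists c : nat -> quat R, forall q, complex_line I q ->
    qabs (q - p) < rho -> series (fun n => (q - p) ^+ n * c n) @ \oo --> f q.
  apply: taylor_disc => // q Iq qp.
  by apply: (slice_regular_line_derivative fO SI Iq); exact: OI.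
(* The neighborhood is centered at the real point a, not at p, so that with x + J y it contains x +
   I y and x - I y. *)
exists [set q | qabs (q - a%:H) < rho - b], c; split.
- apply/nbhs_qabsP; exists (rho - b - b); first by move: bb; rewrite -/b; lra.
  move=> q qp /=; have := qabs_triangle (q - p) (p - a%:H).
  by rewrite addrA subrK pa; lra.
- move=> q qa; have [J [SJ Jq _]] := common_line_refl q.
  by apply: OJ SJ Jq _; exact: ltW.
move=> q /= qa; have [J [SJ [[x y] _ qE] _]] := common_line_refl q.
rewrite -qE in qa *; rewrite (slice_representation rhob SI SJ hola qa).
(* Both points of L_I are within rho - b of a, and a is at distance b from p: they lie in the disc
   of the Taylor expansion at p. *)
have near_p (t : R) : t ^+ 2 = y ^+ 2 -> qabs (slice_pt I (x, t) - p) < rho.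
  move=> ty; have := qabs_triangle (slice_pt I (x, t) - a%:H) (a%:H - p).
  rewrite addrA subrK (qabs_distC (a%:H)) pa.
  suff -> : qabs (slice_pt I (x, t) - a%:H) = qabs (slice_pt J (x, y) - a%:H).
    by move: qa; lra.
  have aE K : a%:H = slice_pt K (a, 0) by rewrite /slice_pt /= scale0r addr0.
  rewrite {1}(aE I) (aE J) -!slice_ptN -!slice_ptD !qabs_slice //=.
  by rewrite oppr0 !addr0 ty.
apply: eq_cvg_seq (cvg_series_quat_comb
  (hc _ (line_pt I (x, y)) (near_p y erefl))
  (hc _ (line_pt I (x, - y)) (near_p (- y) (sqrrN y)))) => n.
apply: eq_bigr => k _.
by rewrite !mulrA -mulrDl (regular_pow_split x y k SI SJ Ip).
Qed.

Lemma real_axis_analytic_locus Omega p : open Omega -> (Omega `&` @real_axis R) p ->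
  nbhs p (analytic_locus Omega).
Proof.
move=> oO [Op [x _ pE]].
have p0 : qabs (qIm p) = 0.
  rewrite -pE (_ : qIm _ = 0) ?qabs0 //.
  by apply: quat_ext; rewrite /qIm !quatE ?mulr0.
have /nbhs_qabsP[e e0 he] := open_nbhs_nbhs (conj oO Op).
(* Within e/4 of p, the double of |Im q| stays below e/2, while the boundary, at distance at least e
   from p, is at least 3e/4 away from q. *)
apply/nbhs_qabsP; exists (e / 4); first by rewrite divr_gt0.
move=> q qp; split; first by apply: he; lra.
have qI := qabs_qImB q p; rewrite p0 addr0 in qI.
apply: (@lt_le_trans _ _ (3 * e / 4)%:E); first by rewrite lte_fin; lra.
apply: le_ereal_inf_tmp => _ [t dt <-]; rewrite lee_fin.
have et : e <= qabs (t - p).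
  rewrite leNgt; apply/negP => te.
  exact: (open_sigma_boundary oO (he t te)).
apply: le_trans (qabs_le_sigma q t).
have := qabs_triangle (t - q) (q - p); rewrite addrA subrK qabs_distC.
by move: et qp; lra.
Qed.

End Analyticity.

Theorem theorem1p11 (R : realType) (Omega : set (quat R))
    (domOmega : domain Omega) :
  (forall f : quat R -> quat R, slice_regular Omega f ->
     forall p : quat R, analytic_locus Omega p ->
       quaternionic_analytic Omega f p) /\
  (Omega `&` @real_axis R !=set0 ->
     exists V : set (quat R),
       [/\ open V, Omega `&` @real_axis R `<=` V & V `<=` analytic_locus Omega]).
Proof.
have [_ oO _] := domOmega; split=> [f fO p|_].
  exact: slice_regular_analytic.
exists (interior (analytic_locus Omega)); split.
- exact: open_interior.
- by move=> p; exact: real_axis_analytic_locus.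
- exact: interior_subset.
Qed.
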